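(* Let $D:\mathbb{R}_+^*\times\mathbb{R}\to\mathbb{R}$, $(\rho,\alpha)\mapsto D(\rho,\alpha)$, be a $\mathcal{C}^1$ drag force which has the same sign as $\alpha$ and vanishes at $\alpha=0$. Suppose that $D$ is an increasing function of $\alpha$ and that $|D|$ is a decreasing function of $\rho$. Then for all states $(\rho_L,q_L)$ and $(\rho_R,q_R)$ in $\mathbb{R}_+^*\times\mathbb{R}$ and for every particle velocity $v\in\mathbb{R}$, the Riemann problem $$\begin{cases}\partial_t\rho+\partial_x q=0,\\ \partial_t q+\partial_x\left(\frac{q^2}{\rho}+c^2\rho\right)=-D(\rho,q-v\rho)\,\delta_{vt},\\ \rho(0,x)=\rho_L\mathbf{1}_{x<0}+\rho_R\mathbf{1}_{x>0},\quad q(0,x)=q_L\mathbf{1}_{x<0}+q_R\mathbf{1}_{x>0}\end{cases}$$ has a unique self-similar solution (in the sense defined in the context).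
   Context: $c>0$ is a fixed constant (sound speed). ''$D$ has the same sign as $\alpha$'' means $D(\rho,\alpha)>0$ for $\alpha>0$ and $D(\rho,\alpha)<0$ for $\alpha<0$. ''$|D|$ decreasing in $\rho$'' is understood in the non-strict sense (drag forces independent of $\rho$ are allowed). Euler Riemann solution. For $(\rho_a,q_a),(\rho_b,q_b)\in\mathbb{R}_+^*\times\mathbb{R}$, $W(x/t;(\rho_a,q_a),(\rho_b,q_b))$ denotes the unique self-similar entropy solution (a $1$-wave followed by a $2$-wave, each an entropy shock or a rarefaction) of the isothermal Euler equations without source, $\partial_t\rho+\partial_x q=0$, $\partial_t q+\partial_x(q^2/\rho+c^2\rho)=0$, with initial data $(\rho_a,q_a)$ for $x<0$ and $(\rho_b,q_b)$ for $x>0$. $W(v_-;\cdot)$ and $W(v_+;\cdot)$ are its left and right limits at $x/t=v$. For $\alpha\neq 0$ let $F_\alpha(\rho)=\int_{|\alpha|/c}^{\rho}\frac{1}{|D(r,\alpha)|}\left(c^2-\frac{\alpha^2}{r^2}\right)dr$. Germ. $\mathcal{G}_D(v)$ is the set of pairs $((\rho_-,q_-),(\rho_+,q_+))\in(\mathbb{R}_+^*\times\mathbb{R})^2$ such that $q_--v\rho_-=q_+-v\rho_+=:\alpha$ and one of the following holds: - $\alpha=0$, $\rho_-=\rho_+$ and $q_-=q_+$; - $\alpha>0$, $(\frac{\alpha}{c}-\rho_+)(\frac{\alpha}{c}-\rho_-)\ge0$ and $F_\alpha(\rho_-)-F_\alpha(\rho_+)=1$; - $\alpha<0$, $(\frac{|\alpha|}{c}-\rho_+)(\frac{|\alpha|}{c}-\rho_-)\ge0$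 and $F_\alpha(\rho_+)-F_\alpha(\rho_-)=1$; - $c\rho_-<\alpha$, $\rho_+\ge\frac{\alpha}{c}$ and there exist $\rho\in[\rho_-,\frac{\alpha}{c})$ and $\theta\in[0,1]$ with $F_\alpha(\rho_-)-F_\alpha(\rho)=\theta$ and $F_\alpha\left(\frac{\alpha^2}{c^2\rho}\right)-F_\alpha(\rho_+)=1-\theta$; - $\alpha<-c\rho_+$, $\rho_-\ge\frac{|\alpha|}{c}$ and there exist $\rho\in[\rho_+,\frac{|\alpha|}{c})$ and $\theta\in[0,1]$ with $F_\alpha(\rho_+)-F_\alpha(\rho)=\theta$ and $F_\alpha\left(\frac{\alpha^2}{c^2\rho}\right)-F_\alpha(\rho_-)=1-\theta$. Self-similar solution. It is a function $(\rho,q)$ of $x/t$ for which there are states $(\rho_-,q_-),(\rho_+,q_+)\in\mathbb{R}_+^*\times\mathbb{R}$ such that: on $\{x<vt\}$, $(\rho,q)=W(x/t;(\rho_L,q_L),(\rho_-,q_-))$, and $W(v_-;(\rho_L,q_L),(\rho_-,q_-))=(\rho_-,q_-)$; on $\{x>vt\}$, $(\rho,q)=W(x/t;(\rho_+,q_+),(\rho_R,q_R))$, and $W(v_+;(\rho_+,q_+),(\rho_R,q_R))=(\rho_+,q_+)$; and $((\rho_-,q_-),(\rho_+,q_+))\in\mathcal{G}_D(v)$ (i.e. the traces along the particle belong to the germ). *)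

(* Defs.v *)
From Stdlib Require Import Reals List.
From Coquelicot Require Import Coquelicot.
Open Scope R_scope.

(* A state (rho, q); the density has to be positive for it to be physical. *)
Notation state := (R * R)%type.

Definition physical (U : state) : Prop := 0 < fst U.

(* Momentum component of the isothermal Euler flux; the mass component is q. *)
Definition momentum_flux (c : R) (U : state) : R :=
  snd U ^ 2 / fst U + c ^ 2 * fst U.

Inductive family := One | Two.

Definition eigenvalue (c : R) (k : family) (U : state) : R :=
  match k with
  | One => snd U / fst U - c
  | Two => snd U / fst U + c
  end.

Definition rankine_hugoniot (c : R) (Ua Ub : state) (s : R) : Prop :=
  snd Ub - snd Ua = s * (fst Ub - fst Ua) /\
  momentum_flux c Ub - momentum_flux c Ua = s * (snd Ub - snd Ua).

Definition lax (c : R) (k : family) (Ua Ub : state) (s : R) : Prop :=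
  eigenvalue c k Ub < s < eigenvalue c k Ua /\
  match k with
  | One => s < eigenvalue c Two Ub
  | Two => eigenvalue c One Ua < s
  end.

Definition entropy_shock (c : R) (k : family) (Ua Ub : state) (s : R) : Prop :=
  rankine_hugoniot c Ua Ub s /\ lax c k Ua Ub s.

(* The profile [w], a function of xi = x/t, is a k-rarefaction fan joining [Ua]
   to [Ub] on [a, b].  The two derivative conditions are the self-similar form
   - xi * U' + (f (U))' = 0 of the Euler equations.  When a = b this is the
   trivial wave, with Ua = Ub. *)
Definition rarefaction (c : R) (k : family) (w : R -> state) (Ua Ub : state)
    (a b : R) : Prop :=
  a <= b /\ w a = Ua /\ w b = Ub /\
  (forall xi, a <= xi <= b -> eigenvalue c k (w xi) = xi) /\
  continuous_on (fun xi => a <= xi <= b) w /\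
  (forall xi, a < xi < b -> exists drho : R,
     is_derive (fun y => fst (w y)) xi drho /\
     is_derive (fun y => snd (w y)) xi (xi * drho) /\
     is_derive (fun y => momentum_flux c (w y)) xi (xi * (xi * drho))).

(* A k-wave of [w] joining [Ua] to [Ub] and occupying the speeds [a, b].  The
   value of [w] at the speed of a shock is not prescribed. *)
Definition wave (c : R) (k : family) (w : R -> state) (Ua Ub : state)
    (a b : R) : Prop :=
  rarefaction c k w Ua Ub a b \/ (a = b /\ entropy_shock c k Ua Ub a).

(* [w] is (a representative of) xi |-> W (xi; Ua, Ub). *)
Definition euler_riemann (c : R) (Ua Ub : state) (w : R -> state) : Prop :=
  (forall xi, physical (w xi)) /\
  exists (Um : state) (a1 b1 a2 b2 : R),
    physical Um /\
    wave c One w Ua Um a1 b1 /\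
    wave c Two w Um Ub a2 b2 /\
    b1 < a2 /\
    (forall xi, xi < a1 -> w xi = Ua) /\
    (forall xi, b1 < xi < a2 -> w xi = Um) /\
    (forall xi, b2 < xi -> w xi = Ub).

(* F_alpha (rho); [RInt] is oriented, so rho may lie below |alpha| / c. *)
Definition F (c : R) (D : R -> R -> R) (alpha rho : R) : R :=
  RInt (fun r => / Rabs (D r alpha) * (c ^ 2 - alpha ^ 2 / r ^ 2))
       (Rabs alpha / c) rho.

Definition germ (c : R) (D : R -> R -> R) (v : R) (Um Up : state) : Prop :=
  physical Um /\ physical Up /\
  let rm := fst Um in
  let rp := fst Up in
  let alpha := snd Um - v * rm in
  alpha = snd Up - v * rp /\
  ( (alpha = 0 /\ rm = rp /\ snd Um = snd Up)
  \/
    (0 < alpha /\ 0 <= (alpha / c - rp) * (alpha / c - rm) /\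
     F c D alpha rm - F c D alpha rp = 1)
  \/
    (alpha < 0 /\ 0 <= (Rabs alpha / c - rp) * (Rabs alpha / c - rm) /\
     F c D alpha rp - F c D alpha rm = 1)
  \/
    (c * rm < alpha /\ alpha / c <= rp /\
     exists rho theta : R,
       rm <= rho < alpha / c /\ 0 <= theta <= 1 /\
       F c D alpha rm - F c D alpha rho = theta /\
       F c D alpha (alpha ^ 2 / (c ^ 2 * rho)) - F c D alpha rp = 1 - theta)
  \/
    (alpha < - (c * rp) /\ Rabs alpha / c <= rm /\
     exists rho theta : R,
       rp <= rho < Rabs alpha / c /\ 0 <= theta <= 1 /\
       F c D alpha rp - F c D alpha rho = theta /\
       F c D alpha (alpha ^ 2 / (c ^ 2 * rho)) - F c D alpha rm = 1 - theta) ).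

(* [w] is a function of xi = x/t; its value on the particle path xi = v is
   irrelevant. *)
Definition self_similar_solution (c : R) (D : R -> R -> R) (v : R)
    (UL UR : state) (w : R -> state) : Prop :=
  exists (Um Up : state) (Wl Wr : R -> state),
    physical Um /\ physical Up /\
    euler_riemann c UL Um Wl /\
    filterlim Wl (at_left v) (locally Um) /\
    (forall xi, xi < v -> w xi = Wl xi) /\
    euler_riemann c Up UR Wr /\
    filterlim Wr (at_right v) (locally Up) /\
    (forall xi, v < xi -> w xi = Wr xi) /\
    germ c D v Um Up.

(* Equality of solutions: they are piecewise smooth, and are only defined up to
   their values at the shock speeds and on the particle path. *)
Definition eq_off_finite (w1 w2 : R -> state) : Prop :=
  exists l : list R, forall xi, ~ In xi l -> w1 xi = w2 xi.

(* [D] is a total function, but only its values for rho > 0 matter.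
   Monotonicity is understood in the non-strict sense. *)
Record drag_force (D : R -> R -> R) : Prop := {
  drag_C1 : forall rho alpha, 0 < rho -> ex_diff_n D 1 rho alpha;
  drag_pos : forall rho alpha, 0 < rho -> 0 < alpha -> 0 < D rho alpha;
  drag_neg : forall rho alpha, 0 < rho -> alpha < 0 -> D rho alpha < 0;
  drag_0 : forall rho, 0 < rho -> D rho 0 = 0;
  drag_incr : forall rho alpha beta, 0 < rho -> alpha <= beta ->
    D rho alpha <= D rho beta;
  drag_decr : forall rho sigma alpha, 0 < rho -> rho <= sigma ->
    Rabs (D sigma alpha) <= Rabs (D rho alpha)
}.

(* Main.v *)
Require Import Defs.
From Stdlib Require Import Reals List Lra Ranalysis5 ClassicalEpsilon FunctionalExtensionality.
From Coquelicot Require Import Coquelicot.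
Open Scope R_scope.

(** Two changes of frame, the Galilean one [shift] and the reflection [mirror] of the
    axis, leave the problem invariant, so that the particle may be taken at rest and only
    fluxes [alpha >= 0] through it need to be studied.

    The left traces.  The states at which a solution issued from [UL] can arrive at
    [xi = 0] are those whose connecting waves have nonpositive speed.  On the forward
    1-wave curve of [UL] these are the densities beyond [crit UL], where the momentum is
    strictly decreasing; inverting it gives the density [ell UL alpha] of the trace of
    flux [alpha], a continuous and decreasing function of [alpha].  Apart from this curve
    the left traces are [UL] itself, when it is supersonic ([trace_nonneg_inv]), and, for
    negative fluxes, sufficiently supersonic states reached through 2-waves
    ([trace_neg_inv]).  The right traces are the mirror image; their densities for the
    flux [alpha > 0] are [right_threshold alpha], which is the larger of the density on
    the curve and the sonic one, and everything below its conjugate by a stationary shock.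

    The particle.  For a flux [alpha > 0] the germ asks that the loss, measured by
    [F alpha], be 1 between the two traces.  If the flow is subsonic on the left, this
    says that [gap alpha = F alpha (ell UL alpha) - F alpha (right_threshold alpha)] is
    equal to 1.  Now [gap] is continuous, and strictly decreasing where
    it is positive ([gap_decr]): when the
    flux grows the interval between the two densities shrinks, and the drag, being
    nondecreasing in [alpha], makes each density contribute less.  It tends to infinity
    with [1 / D] when [alpha] tends to 0, provided that [ell UL 0] exceeds its right
    counterpart.  So there is exactly one regular connection of positive flux, unless
    [gap] is still at least 1 at the largest possible flux.  This happens only if [UL] is
    supersonic, and the flux is then that of [UL], which enters the particle as it is
    (the choked regime).  Inside the particle the flow stays supersonic or undergoes a
    stationary shock; as [|D|] is nonincreasing in the density, shocking later never
    increases the loss ([shock_gain_decr]).  The exits available through a shock thus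
    form an interval bounded by the conjugate of the supersonic exit, and exactly one
    exit is a right trace ([choked_exists], [choked_unique]).

    Conclusion.  A connection of positive flux exists if and only if [ell UL 0] is larger
    than [ell (mirror UR) 0], one of zero flux if and only if they are equal, and one of
    negative flux in the remaining case, by reflection.  Hence the pair of traces exists
    and is unique, and each side is then the solution of an ordinary Riemann problem,
    unique because the densities on the two wave curves determine the velocity
    monotonically ([euler_unique]). *)

(** * Symmetries *)

Definition mirror (U : state) : state := (fst U, - snd U).
Definition mirror_profile (w : R -> state) (xi : R) : state := mirror (w (- xi)).
Definition dual (k : Defs.family) : Defs.family :=
  match k with One => Two | Two => One end.

Definition shift (a : R) (U : state) : state := (fst U, snd U - a * fst U).
Definition shift_profile (a : R) (w : R -> state) (xi : R) : state :=
  shift a (w (xi + a)).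

Lemma mirrorK U : mirror (mirror U) = U.
Proof. destruct U; unfold mirror; simpl; f_equal; ring. Qed.

Lemma mirror_profileK w xi : mirror_profile (mirror_profile w) xi = w xi.
Proof. unfold mirror_profile; rewrite mirrorK; f_equal; ring. Qed.

Lemma shiftK a U : shift (- a) (shift a U) = U.
Proof. destruct U; unfold shift; simpl; f_equal; ring. Qed.

Lemma mirror_physical U : physical U -> physical (mirror U).
Proof. easy. Qed.

Lemma shift_physical a U : physical U -> physical (shift a U).
Proof. easy. Qed.

Lemma mirror_eigenvalue c k U :
  eigenvalue c (dual k) (mirror U) = - eigenvalue c k U.
Proof. destruct k; unfold Rdiv; simpl; unfold Rdiv; ring. Qed.

Lemma shift_eigenvalue c a k U : physical U ->
  eigenvalue c k (shift a U) = eigenvalue c k U - a.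
Proof. unfold physical; destruct k; simpl; intros; field; lra. Qed.

Lemma mirror_momentum c U : momentum_flux c (mirror U) = momentum_flux c U.
Proof. unfold momentum_flux, mirror; simpl; unfold Rdiv; ring. Qed.

Lemma shift_momentum c a U : physical U ->
  momentum_flux c (shift a U) =
  momentum_flux c U - 2 * a * snd U + a ^ 2 * fst U.
Proof. unfold physical, momentum_flux, shift; simpl; intros; field; lra. Qed.

(** Continuity on an interval is continuity within it, so a change of variable has to map
    one interval into the other. *)
Lemma continuous_on_transport (f : R -> R) (g : state -> state) (w : R -> state)
    (P Q : R -> Prop) :
  (forall x, continuous f x) -> (forall U, continuous g U) ->
  (forall x, Q x -> P (f x)) ->
  continuous_on P w -> continuous_on Q (fun x => g (w (f x))).
Proof.
  intros Hf Hg HPQ Hw x Hx.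
  apply (filterlim_comp _ _ _ (fun x => w (f x)) g _ (locally (w (f x)))).
  2: apply Hg.
  apply (filterlim_comp _ _ _ f w _ (within P (locally (f x)))).
  2: apply Hw, HPQ, Hx.
  intros A HA.
  generalize (Hf x _ HA); unfold filtermap, within.
  apply filter_imp; intros y Hy Qy; apply Hy, HPQ, Qy.
Qed.

Lemma mirror_continuous U : continuous mirror U.
Proof.
  unfold mirror.
  apply (continuous_comp_2 (fst : state -> R) (fun U : state => - snd U)
    (fun x y => (x, y))).
  - apply continuous_fst.
  - apply (continuous_opp (snd : state -> R)), continuous_snd.
  - destruct (fst U, - snd U); apply continuous_ext with (fun p => p).
    intros []; reflexivity. apply continuous_id.
Qed.

Lemma shift_continuous a U : continuous (shift a) U.
Proof.
  unfold shift.
  apply (continuous_comp_2 (fst : state -> R)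
    (fun U : state => snd U - a * fst U) (fun x y => (x, y))).
  - apply continuous_fst.
  - apply (continuous_minus (snd : state -> R) (fun U : state => a * fst U)).
    apply continuous_snd.
    apply (continuous_scal_r a (fst : state -> R)), continuous_fst.
  - destruct (fst U, snd U - a * fst U); apply continuous_ext with (fun p => p).
    intros []; reflexivity. apply continuous_id.
Qed.

Lemma mirror_rarefaction c k w Ua Ub a b :
  rarefaction c k w Ua Ub a b ->
  rarefaction c (dual k) (mirror_profile w) (mirror Ub) (mirror Ua) (- b) (- a).
Proof.
  intros (Hab & Ha & Hb & He & Hc & Hd); unfold mirror_profile.
  repeat split.
  - lra.
  - rewrite Ropp_involutive, Hb; reflexivity.
  - rewrite Ropp_involutive, Ha; reflexivity.
  - intros xi Hxi; rewrite mirror_eigenvalue, He; lra.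
  - apply (continuous_on_transport Ropp mirror w (fun xi => a <= xi <= b)).
    + intros x; apply (ex_derive_continuous (fun x : R => - x)).
      auto_derive; easy.
    + apply mirror_continuous.
    + intros x; lra.
    + exact Hc.
  - intros xi Hxi. destruct (Hd (- xi)) as (d & H1 & H2 & H3). lra.
    exists (- d).
    assert (Hopp : is_derive (fun y : R => - y) xi (-1)).
    { auto_derive; [easy | ring]. }
    split; [| split].
    + generalize (is_derive_comp _ _ xi _ _ H1 Hopp).
      intros G; replace (- d) with (scal (-1) d). exact G.
      unfold scal; simpl; unfold mult; simpl; ring.
    + generalize (is_derive_opp _ _ _ (is_derive_comp _ _ xi _ _ H2 Hopp)).
      intros G; replace (xi * - d) with (opp (scal (-1) (- xi * d))). exact G.
      unfold opp, scal; simpl; unfold mult; simpl; ring.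
    + generalize (is_derive_comp _ _ xi _ _ H3 Hopp).
      intros G; replace (xi * (xi * - d)) with (scal (-1) (- xi * (- xi * d))).
      revert G; apply is_derive_ext; intros t; rewrite mirror_momentum; easy.
      unfold scal; simpl; unfold mult; simpl; ring.
Qed.

(** The third derivative condition is preserved because the momentum flux changes by a
    combination of the two conserved quantities, which satisfy the first two. *)
Lemma shift_rarefaction c v k w Ua Ub a b :
  (forall xi, physical (w xi)) ->
  rarefaction c k w Ua Ub a b ->
  rarefaction c k (shift_profile v w) (shift v Ua) (shift v Ub) (a - v) (b - v).
Proof.
  intros Hw (Hab & Ha & Hb & He & Hc & Hd); unfold shift_profile.
  repeat split.
  - lra.
  - replace (a - v + v) with a by ring; rewrite Ha; reflexivity.
  - replace (b - v + v) with b by ring; rewrite Hb; reflexivity.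
  - intros xi Hxi; rewrite shift_eigenvalue, He; [ring | lra | apply Hw].
  - apply (continuous_on_transport (fun x => x + v) (shift v) w
      (fun xi => a <= xi <= b)).
    + intros x; apply (ex_derive_continuous (fun x : R => x + v)).
      auto_derive; easy.
    + apply shift_continuous.
    + intros x; lra.
    + exact Hc.
  - intros xi Hxi. destruct (Hd (xi + v)) as (d & H1 & H2 & H3). lra.
    exists d.
    assert (Hs : is_derive (fun y : R => y + v) xi 1).
    { auto_derive; [easy | ring]. }
    assert (K1 := is_derive_comp _ _ xi _ _ H1 Hs).
    assert (K2 := is_derive_comp _ _ xi _ _ H2 Hs).
    assert (K3 := is_derive_comp _ _ xi _ _ H3 Hs).
    unfold scal in K1, K2, K3; simpl in K1, K2, K3;
      unfold mult in K1, K2, K3; simpl in K1, K2, K3.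
    split; [| split].
    + replace d with (1 * d) by ring. exact K1.
    + replace (xi * d) with ((1 * ((xi + v) * d)) - v * (1 * d)) by ring.
      apply (is_derive_minus (fun y => snd (w (y + v)))
        (fun y => v * fst (w (y + v)))). exact K2.
      apply (is_derive_scal (fun y => fst (w (y + v)))). exact K1.
    + apply is_derive_ext with (fun y => momentum_flux c (w (y + v))
        - 2 * v * snd (w (y + v)) + v ^ 2 * fst (w (y + v))).
      intros t; rewrite shift_momentum; [reflexivity | apply Hw].
      replace (xi * (xi * d)) with
        (1 * ((xi + v) * ((xi + v) * d)) - 2 * v * (1 * ((xi + v) * d))
         + v ^ 2 * (1 * d)) by ring.
      apply (is_derive_plus (fun y => momentum_flux c (w (y + v))
        - 2 * v * snd (w (y + v))) (fun y => v ^ 2 * fst (w (y + v)))).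
      apply (is_derive_minus (fun y => momentum_flux c (w (y + v)))
        (fun y => 2 * v * snd (w (y + v)))). exact K3.
      apply (is_derive_scal (fun y => snd (w (y + v)))). exact K2.
      apply (is_derive_scal (fun y => fst (w (y + v)))). exact K1.
Qed.

Lemma mirror_shock c k Ua Ub s :
  entropy_shock c k Ua Ub s ->
  entropy_shock c (dual k) (mirror Ub) (mirror Ua) (- s).
Proof.
  intros ((H1 & H2) & (H3 & H4)).
  split; split; rewrite ?mirror_eigenvalue, ?mirror_momentum.
  - simpl; lra.
  - rewrite <- (Ropp_involutive (momentum_flux c Ua)); simpl; nra.
  - lra.
  - destruct k; simpl in H4 |- *; unfold Rdiv in *; rewrite Ropp_mult_distr_l_reverse; lra.
Qed.

Lemma shift_shock c v k Ua Ub s :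
  physical Ua -> physical Ub ->
  entropy_shock c k Ua Ub s ->
  entropy_shock c k (shift v Ua) (shift v Ub) (s - v).
Proof.
  intros Pa Pb ((H1 & H2) & (H3 & H4)).
  split; split; rewrite ?shift_eigenvalue, ?shift_momentum by assumption.
  - simpl; lra.
  - simpl; nra.
  - lra.
  - destruct k; lra.
Qed.

Lemma mirror_wave c k w Ua Ub a b :
  wave c k w Ua Ub a b ->
  wave c (dual k) (mirror_profile w) (mirror Ub) (mirror Ua) (- b) (- a).
Proof.
  intros [H | [-> H]].
  - left; apply mirror_rarefaction, H.
  - right; split; [reflexivity | apply mirror_shock, H].
Qed.

Lemma shift_wave c v k w Ua Ub a b :
  (forall xi, physical (w xi)) -> physical Ua -> physical Ub ->
  wave c k w Ua Ub a b ->
  wave c k (shift_profile v w) (shift v Ua) (shift v Ub) (a - v) (b - v).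
Proof.
  intros Hw Pa Pb [H | [-> H]].
  - left; apply shift_rarefaction; assumption.
  - right; split; [reflexivity | apply shift_shock; assumption].
Qed.

Lemma mirror_euler c Ua Ub w :
  euler_riemann c Ua Ub w ->
  euler_riemann c (mirror Ub) (mirror Ua) (mirror_profile w).
Proof.
  intros (Hw & Um & a1 & b1 & a2 & b2 & Pm & W1 & W2 & Hlt & E1 & E2 & E3).
  split. intros xi; apply mirror_physical, Hw.
  exists (mirror Um), (- b2), (- a2), (- b1), (- a1).
  split. apply mirror_physical, Pm.
  split. apply (mirror_wave c Two), W2.
  split. apply (mirror_wave c One), W1.
  unfold mirror_profile.
  repeat split; [lra | | |]; intros xi Hxi.
  - rewrite E3; [reflexivity | lra].
  - rewrite E2; [reflexivity | lra].
  - rewrite E1; [reflexivity | lra].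
Qed.

Lemma shift_euler c v Ua Ub w :
  physical Ua -> physical Ub ->
  euler_riemann c Ua Ub w ->
  euler_riemann c (shift v Ua) (shift v Ub) (shift_profile v w).
Proof.
  intros Pa Pb
    (Hw & Um & a1 & b1 & a2 & b2 & Pm & W1 & W2 & Hlt & E1 & E2 & E3).
  split. intros xi; apply shift_physical, Hw.
  exists (shift v Um), (a1 - v), (b1 - v), (a2 - v), (b2 - v).
  split. apply shift_physical, Pm.
  split. apply shift_wave; assumption.
  split. apply shift_wave; assumption.
  unfold shift_profile.
  repeat split; [lra | | |]; intros xi Hxi.
  - rewrite E1; [reflexivity | lra].
  - rewrite E2; [reflexivity | lra].
  - rewrite E3; [reflexivity | lra].
Qed.

(** The reflection exchanges the two sides of the particle, hence the sign of both the
    flux and the force. *)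
Definition mirror_drag (D : R -> R -> R) (rho alpha : R) : R :=
  - D rho (- alpha).

Lemma mirror_dragK D : mirror_drag (mirror_drag D) = D.
Proof.
  apply functional_extensionality; intros rho.
  apply functional_extensionality; intros alpha.
  unfold mirror_drag; rewrite !Ropp_involutive; reflexivity.
Qed.

Lemma mirror_F c D alpha rho :
  F c (mirror_drag D) alpha rho = F c D (- alpha) rho.
Proof.
  unfold F, mirror_drag; rewrite Rabs_Ropp.
  apply RInt_ext; intros r _; rewrite Rabs_Ropp.
  f_equal; unfold Rdiv; ring.
Qed.

Lemma mirror_germ c D v Um Up : 0 < c ->
  germ c D v Um Up ->
  germ c (mirror_drag D) (- v) (mirror Up) (mirror Um).
Proof.
  intros c_pos (Pm & Pp & H). split; [exact Pp | split; [exact Pm |]].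
  revert H; simpl.
  set (alpha := snd Um - v * fst Um).
  replace (- snd Up - - v * fst Up) with (- (snd Up - v * fst Up)) by ring.
  replace (- snd Um - - v * fst Um) with (- (snd Um - v * fst Um)) by ring.
  fold alpha.
  intros [Ha H]; rewrite <- Ha.
  split; [reflexivity |].
  rewrite !mirror_F, !Ropp_involutive, !Rabs_Ropp.
  destruct H as [(H1 & H2 & H3) | [(H1 & H2 & H3) | [(H1 & H2 & H3) |
    [(H1 & H2 & rho & theta & H3) | (H1 & H2 & rho & theta & H3)]]]].
  - left; repeat split; lra.
  - do 2 right; left; repeat split; try lra.
    rewrite Rabs_right by lra; lra.
  - right; left; repeat split; try lra.
    rewrite Rabs_left in H2 by lra; lra.
  - assert (0 < alpha) by (unfold physical in Pm; nra).
    rewrite Rabs_right by lra.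
    do 4 right; repeat split; try lra.
    exists rho, theta; rewrite !mirror_F, !Ropp_involutive.
    replace (- alpha * (- alpha * 1)) with (alpha * (alpha * 1)) by ring.
    tauto.
  - assert (alpha < 0) by (unfold physical in Pp; nra).
    rewrite Rabs_left in H2, H3 by lra.
    do 3 right; left; repeat split; try lra.
    exists rho, theta; rewrite !mirror_F, !Ropp_involutive.
    replace (- alpha * (- alpha * 1)) with (alpha * (alpha * 1)) by ring.
    tauto.
Qed.

Lemma shift_germ c D v Um Up :
  germ c D v Um Up -> germ c D 0 (shift v Um) (shift v Up).
Proof.
  intros (Pm & Pp & H). split; [exact Pm | split; [exact Pp |]].
  revert H; simpl. rewrite !Rmult_0_l, !Rminus_0_r.
  set (alpha := snd Um - v * fst Um).
  intros [Ha H]; rewrite <- Ha; split; [reflexivity |].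
  destruct H as [(H1 & H2 & H3) | H]; [left | right; exact H].
  tauto.
Qed.

Lemma unshift_germ c D v Um Up :
  germ c D 0 Um Up -> germ c D v (shift (- v) Um) (shift (- v) Up).
Proof.
  intros (Pm & Pp & H). split; [exact Pm | split; [exact Pp |]].
  revert H; simpl. rewrite !Rmult_0_l, !Rminus_0_r.
  replace (snd Um - - v * fst Um - v * fst Um) with (snd Um) by ring.
  replace (snd Up - - v * fst Up - v * fst Up) with (snd Up) by ring.
  intros [Ha H]; rewrite <- Ha; split; [reflexivity |].
  destruct H as [(H1 & H2 & H3) | H]; [left | right; exact H].
  rewrite H2; tauto.
Qed.

(** The hypotheses on the drag in a form that passes easily to [mirror_drag]: continuity
    stands for C1 regularity, whose iterated partial derivatives do not. *)
Record admissible (D : R -> R -> R) : Prop := {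
  adm_cont : forall rho alpha, 0 < rho -> continuity_2d_pt D rho alpha;
  adm_pos : forall rho alpha, 0 < rho -> 0 < alpha -> 0 < D rho alpha;
  adm_neg : forall rho alpha, 0 < rho -> alpha < 0 -> D rho alpha < 0;
  adm_0 : forall rho, 0 < rho -> D rho 0 = 0;
  adm_incr : forall rho alpha beta, 0 < rho -> alpha <= beta ->
    D rho alpha <= D rho beta;
  adm_decr : forall rho sigma alpha, 0 < rho -> rho <= sigma ->
    Rabs (D sigma alpha) <= Rabs (D rho alpha)
}.

Lemma drag_admissible D : drag_force D -> admissible D.
Proof.
  intros [H1 H2 H3 H4 H5 H6]; constructor; auto.
  intros rho alpha Hr; apply (H1 rho alpha Hr).
Qed.

Lemma mirror_admissible D : admissible D -> admissible (mirror_drag D).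
Proof.
  intros [H1 H2 H3 H4 H5 H6]; unfold mirror_drag; constructor.
  - intros rho alpha Hr. apply continuity_2d_pt_opp.
    apply continuity_2d_pt_filterlim.
    apply (filterlim_comp _ _ _ (fun z : R * R => (fst z, - snd z))
      (fun z => D (fst z) (snd z)) _ (locally (rho, - alpha))).
    apply (mirror_continuous (rho, alpha)).
    apply continuity_2d_pt_filterlim, H1, Hr.
  - intros rho alpha Hr Ha. generalize (H3 rho (- alpha) Hr); lra.
  - intros rho alpha Hr Ha. generalize (H2 rho (- alpha) Hr); lra.
  - intros rho Hr; rewrite Ropp_0, H4; lra.
  - intros rho alpha beta Hr Hab.
    apply Ropp_le_contravar, H5; lra.
  - intros rho sigma alpha Hr Hs; rewrite !Rabs_Ropp; auto.
Qed.

(** * Wave curves *)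

(** Drop of velocity, in units of [c], along the 1-wave curve from the density [a] to the
    density [x]: [ln (x / a)] on a fan ([x <= a]) and [(x - a) / sqrt (a * x)] across a
    shock ([a <= x]).  With [Rmin] and [Rmax] one of the two summands vanishes, and the
    continuity at [x = a] needs no gluing. *)
Definition phi (a x : R) : R :=
  (ln (Rmin a x) - ln a) + (Rmax a x - a) / sqrt (a * Rmax a x).

(** Difference, in units of [c], between the initial velocity and the speed at which the
    same wave ends: [u - c] behind a fan, the speed of the shock otherwise. *)
Definition psi (a x : R) : R :=
  (1 + ln (Rmin a x) - ln a) + (sqrt (a * Rmax a x) / a - 1).

Lemma sqrt_mult_pos a x : 0 < a -> 0 < x ->
  0 < sqrt (a * x) /\ sqrt (a * x) * sqrt (a * x) = a * x.
Proof.
  intros Ha Hx. assert (0 < a * x) by (apply Rmult_lt_0_compat; lra).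
  split. apply sqrt_lt_R0; lra. apply sqrt_sqrt; lra.
Qed.

Lemma sqrt_mult_self a : 0 < a -> sqrt (a * a) = a.
Proof. intros; apply sqrt_square; lra. Qed.

Lemma phi_le a x : 0 < a -> x <= a -> phi a x = ln x - ln a.
Proof.
  intros Ha Hx; unfold phi; rewrite Rmin_right, Rmax_left by lra.
  unfold Rdiv; ring.
Qed.

Lemma phi_ge a x : 0 < a -> a <= x -> phi a x = (x - a) / sqrt (a * x).
Proof.
  intros Ha Hx; unfold phi; rewrite Rmin_left, Rmax_right by lra.
  unfold Rdiv; ring.
Qed.

Lemma psi_le a x : 0 < a -> x <= a -> psi a x = 1 + (ln x - ln a).
Proof.
  intros Ha Hx; unfold psi; rewrite Rmin_right, Rmax_left by lra.
  rewrite sqrt_mult_self by lra. field; lra.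
Qed.

Lemma psi_ge a x : 0 < a -> a <= x -> psi a x = sqrt (a * x) / a.
Proof.
  intros Ha Hx; unfold psi; rewrite Rmin_left, Rmax_right by lra.
  ring.
Qed.

Lemma phi_self a : 0 < a -> phi a a = 0.
Proof. intros; rewrite phi_le; lra. Qed.

Lemma psi_self a : 0 < a -> psi a a = 1.
Proof. intros; rewrite psi_le; lra. Qed.

Lemma psi_incr a x y : 0 < a -> 0 < x -> x < y -> psi a x < psi a y.
Proof.
  intros Ha Hx Hxy.
  assert (G1 : forall x y, 0 < x -> x < y -> y <= a -> psi a x < psi a y).
  { intros; rewrite !psi_le by lra.
    assert (ln x0 < ln y0) by (apply ln_increasing; lra). lra. }
  assert (G2 : forall x y, a <= x -> x < y -> psi a x < psi a y).
  { intros; rewrite !psi_ge by lra.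
    apply Rmult_lt_compat_r. apply Rinv_0_lt_compat; lra.
    apply sqrt_lt_1_alt; split; nra. }
  destruct (Rle_or_lt y a); [apply G1; lra |].
  destruct (Rle_or_lt a x); [apply G2; lra |].
  generalize (G1 x a) (G2 a y); lra.
Qed.

(** With [k = sqrt (a * x)] one has [x = k^2 / a], so that [(x - a) / k] splits as
    [k / a - a / k]: both terms are then monotone. *)
Lemma phi_shock a x : 0 < a -> a <= x ->
  phi a x = psi a x - a / sqrt (a * x).
Proof.
  intros Ha Hx; rewrite phi_ge, psi_ge by lra.
  destruct (sqrt_mult_pos a x) as [Hk Hkk]; try lra.
  set (k := sqrt (a * x)) in *.
  replace x with (k * k / a) by (rewrite Hkk; field; lra). field; lra.
Qed.

Lemma phi_incr a x y : 0 < a -> 0 < x -> x < y -> phi a x < phi a y.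
Proof.
  intros Ha Hx Hxy.
  assert (G1 : forall x y, 0 < x -> x < y -> y <= a -> phi a x < phi a y).
  { intros; rewrite !phi_le by lra.
    assert (ln x0 < ln y0) by (apply ln_increasing; lra). lra. }
  assert (G2 : forall x y, a <= x -> x < y -> phi a x < phi a y).
  { intros s t Hs Hst; rewrite !phi_shock by lra.
    assert (psi a s < psi a t) by (apply psi_incr; lra).
    assert (a / sqrt (a * t) < a / sqrt (a * s)); [| lra].
    apply Rmult_lt_compat_l; [lra |]. apply Rinv_lt_contravar.
    apply Rmult_lt_0_compat; apply sqrt_lt_R0; nra.
    apply sqrt_lt_1_alt; split; nra. }
  destruct (Rle_or_lt y a); [apply G1; lra |].
  destruct (Rle_or_lt a x); [apply G2; lra |].
  generalize (G1 x a) (G2 a y); lra.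
Qed.

Lemma phi_incr_le a x y : 0 < a -> 0 < x -> x <= y -> phi a x <= phi a y.
Proof.
  intros Ha Hx [H | ->]; [left; apply phi_incr; lra | lra].
Qed.

Lemma continuity_Rmin a x : continuity_pt (Rmin a) x.
Proof.
  apply continuity_pt_ext with (fun y => (a + y - Rabs (a - y)) / 2).
  - intros y; unfold Rmin, Rabs; destruct (Rle_dec a y), (Rcase_abs (a - y)); lra.
  - apply continuity_pt_filterlim.
    apply (continuous_mult (fun y : R => a + y - Rabs (a - y)) (fun _ => / 2)).
    2: apply continuous_const.
    apply (continuous_minus (fun y : R => a + y) (fun y => Rabs (a - y))).
    apply (ex_derive_continuous (fun y : R => a + y)); auto_derive; easy.
    apply continuous_Rabs_comp, (ex_derive_continuous (fun y : R => a - y)).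
    auto_derive; easy.
Qed.

Lemma continuity_Rmax a x : continuity_pt (Rmax a) x.
Proof.
  apply continuity_pt_ext with (fun y => a + y - Rmin a y).
  - intros y; unfold Rmin, Rmax; destruct (Rle_dec a y); lra.
  - apply continuity_pt_minus; [| apply continuity_Rmin].
    apply continuity_pt_plus; [apply continuity_pt_const; now intros ? ? |].
    apply continuity_pt_id.
Qed.

Lemma continuity_pt_derivable f x : ex_derive f x -> continuity_pt f x.
Proof.
  intros H; apply continuity_pt_filterlim, (ex_derive_continuous f x H).
Qed.

Lemma phi_continuous a x : 0 < a -> 0 < x -> continuity_pt (phi a) x.
Proof.
  intros Ha Hx.
  assert (0 < Rmin a x) by (apply Rmin_pos; lra).
  assert (a <= Rmax a x) by apply Rmax_l.
  apply (continuity_pt_plus (fun x => ln (Rmin a x) - ln a)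
    (fun x => (Rmax a x - a) / sqrt (a * Rmax a x))).
  - apply (continuity_pt_comp (Rmin a) (fun z => ln z - ln a)).
    apply continuity_Rmin. apply continuity_pt_derivable; auto_derive; lra.
  - apply (continuity_pt_comp (Rmax a) (fun z => (z - a) / sqrt (a * z))).
    apply continuity_Rmax. apply continuity_pt_derivable; auto_derive.
    assert (0 < a * Rmax a x) by nra.
    assert (0 < sqrt (a * Rmax a x)) by (apply sqrt_lt_R0; lra).
    repeat split; lra.
Qed.

(** Together with [end_speed] below this is the Lax inequality: a 1-wave ends at a speed
    not smaller than the first eigenvalue behind it. *)
Lemma psi_le_phi a x : 0 < a -> 0 < x -> psi a x <= 1 + phi a x.
Proof.
  intros Ha Hx. destruct (Rle_or_lt x a).
  - rewrite psi_le, phi_le; lra.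
  - rewrite phi_shock by lra.
    destruct (sqrt_mult_pos a x) as [Hk Hkk]; try lra.
    assert (a <= sqrt (a * x)) by nra.
    assert (a / sqrt (a * x) <= 1); [| lra].
    apply Rmult_le_reg_r with (sqrt (a * x)); [lra |].
    field_simplify; lra.
Qed.

(** * One-waves *)

Section Waves.
Variable c : R.
Hypothesis c_pos : 0 < c.

Definition vel (U : state) : R := snd U / fst U.

(** Velocity along the forward 1-wave curve of [U], at density [x]. *)
Definition curve_vel (U : state) (x : R) : R := vel U - c * phi (fst U) x.
Definition curve_mom (U : state) (x : R) : R := x * curve_vel U x.
(** Speed at which the 1-wave from [U] to the density [x] ends. *)
Definition end_speed (U : state) (x : R) : R := vel U - c * psi (fst U) x.
Definition start_speed (U : state) (x : R) : R :=
  if Rle_dec x (fst U) then vel U - c else end_speed U x.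

Lemma state_eq (U V : state) : fst U = fst V -> snd U = snd V -> U = V.
Proof. destruct U, V; simpl; congruence. Qed.

Lemma snd_vel U : physical U -> snd U = fst U * vel U.
Proof. unfold vel, physical; intros; field; lra. Qed.

(** Seen from the shock, mass crosses it at the rate [j = rho * (u - s)] on both sides, and
    the momentum condition becomes [j^2 = c^2 * rho_a * rho_b].  The Lax inequalities say
    that [j] lies strictly between [c * rho_a] and [c * rho_b], which selects the sign of
    [j] and the direction of compression. *)
Lemma shock_One_iff Ua Ub s : physical Ua -> physical Ub ->
  entropy_shock c One Ua Ub s <->
  fst Ua < fst Ub /\ vel Ub = curve_vel Ua (fst Ub) /\
  s = end_speed Ua (fst Ub).
Proof.
  unfold physical; intros Pa Pb.
  assert (Ea := snd_vel Ua Pa). assert (Eb := snd_vel Ub Pb).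
  unfold entropy_shock, rankine_hugoniot, lax, momentum_flux, curve_vel, end_speed.
  simpl eigenvalue. fold (vel Ua) (vel Ub).
  set (a := fst Ua) in *. set (b := fst Ub) in *.
  set (ua := vel Ua) in *. set (ub := vel Ub) in *.
  rewrite Ea, Eb.
  replace ((b * ub) ^ 2 / b) with (b * ub ^ 2) by (field; lra).
  replace ((a * ua) ^ 2 / a) with (a * ua ^ 2) by (field; lra).
  destruct (sqrt_mult_pos a b Pa Pb) as [Hk Hkk].
  split.
  - intros ((H1 & H2) & (H3 & H4)).
    set (j := a * (ua - s)).
    assert (Hj : j = b * (ub - s)) by (unfold j; lra).
    assert (Hja : c * a < j) by (unfold j; nra).
    assert (Hjb : j < c * b) by (rewrite Hj; nra).
    assert (a < b) by nra.
    assert (Hjj : j * j = c * c * (a * b)).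
    { assert (Hua : ua = s + j / a) by (unfold j; field; lra).
      assert (Hub : ub = s + j / b) by (rewrite Hj; field; lra).
      rewrite Hua, Hub in H2.
      apply Rmult_eq_reg_r with ((b - a) / (a * b)).
      2: { apply Rgt_not_eq, Rdiv_lt_0_compat; nra. }
      assert (j * j * ((b - a) / (a * b)) - c * c * (a * b) * ((b - a) / (a * b))
        = 0); [| lra].
      transitivity (s * (b * (s + j / b) - a * (s + j / a)) -
       (b * (s + j / b) ^ 2 + c ^ 2 * b - (a * (s + j / a) ^ 2 + c ^ 2 * a)));
      [ field | ]; lra. }
    assert (Hjk : j = c * sqrt (a * b)).
    { apply Rsqr_inj; unfold Rsqr; nra. }
    rewrite phi_shock, psi_ge by lra.
    set (k := sqrt (a * b)) in *.
    assert (Hs : s = ua - c * (k / a)).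
    { replace (c * (k / a)) with (j / a) by (rewrite Hjk; field; lra).
      unfold j; field; lra. }
    split; [lra | split; [| exact Hs]].
    replace (ub) with (s + j / b) by (rewrite Hj; field; lra).
    rewrite Hs, Hjk.
    replace b with (k * k / a) at 1 by (rewrite Hkk; field; lra).
    field; lra.
  - intros (Hab & H2 & H3).
    rewrite phi_shock in H2 by lra. rewrite psi_ge in H2, H3 by lra.
    set (k := sqrt (a * b)) in *.
    assert (a < k) by nra. assert (k < b) by nra.
    assert (Hu : ub = s + c * (a / k)) by lra.
    assert (Hua : ua = s + c * (k / a)) by lra.
    assert (Hb : b = k * k / a) by (rewrite Hkk; field; lra).
    assert (a / k < 1). { apply Rmult_lt_reg_r with k; field_simplify; lra. }
    assert (1 < k / a). { apply Rmult_lt_reg_r with a; field_simplify; lra. }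
    assert (0 < a / k) by (apply Rdiv_lt_0_compat; lra).
    split; split.
    + rewrite Hu, Hua, Hb; field; lra.
    + rewrite Hu, Hua, Hb; field; lra.
    + nra.
    + nra.
Qed.

(** The 1-fan through [U], where the first eigenvalue [u - c] is equal to [xi] and the
    density decays like [exp (- xi / c)]. *)
Definition fan (U : state) (xi : R) : state :=
  let r := fst U * exp ((vel U - c - xi) / c) in (r, r * (xi + c)).

Lemma fan_physical U xi : physical U -> physical (fan U xi).
Proof.
  unfold physical; intros; simpl; apply Rmult_lt_0_compat; [lra | apply exp_pos].
Qed.

Lemma vel_fan U xi : physical U -> vel (fan U xi) = xi + c.
Proof.
  intros H; generalize (fan_physical U xi H); unfold vel, physical; simpl.
  intros; field; split; [apply Rgt_not_eq, exp_pos | unfold physical in H; lra].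
Qed.

Lemma fan_curve U xi : physical U -> vel U - c <= xi ->
  fst (fan U xi) <= fst U /\
  phi (fst U) (fst (fan U xi)) = (vel U - c - xi) / c.
Proof.
  intros P H. unfold physical in P.
  assert (E : (vel U - c - xi) / c <= 0).
  { apply Rmult_le_reg_r with c; [lra | field_simplify; lra]. }
  assert (L : fst (fan U xi) <= fst U).
  { simpl. assert (exp ((vel U - c - xi) / c) <= 1); [| nra].
    rewrite <- exp_0. destruct E as [E | ->]; [left; apply exp_increasing, E | lra]. }
  split; [exact L |].
  rewrite phi_le by assumption. simpl.
  rewrite ln_mult, ln_exp; [lra | lra | apply exp_pos].
Qed.

Lemma fan_at_end Ua Ub : physical Ua -> physical Ub -> fst Ub <= fst Ua ->
  vel Ub = curve_vel Ua (fst Ub) -> fan Ua (vel Ub - c) = Ub.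
Proof.
  intros Pa Pb Hle Hv. unfold physical in Pa, Pb.
  assert (E : fst Ua * exp ((vel Ua - c - (vel Ub - c)) / c) = fst Ub).
  { rewrite Hv. unfold curve_vel. rewrite phi_le by lra.
    replace ((vel Ua - c - (vel Ua - c * (ln (fst Ub) - ln (fst Ua)) - c)) / c)
      with (ln (fst Ub) + - ln (fst Ua)) by (field; lra).
    rewrite exp_plus, exp_Ropp, !exp_ln by lra. field; lra. }
  apply state_eq; unfold fan; simpl; rewrite E; [reflexivity |].
  rewrite snd_vel by assumption. f_equal; ring.
Qed.

Lemma fan_self U : physical U -> fan U (vel U - c) = U.
Proof.
  intros P; apply fan_at_end; try lra; try assumption.
  unfold curve_vel; rewrite phi_self by assumption; ring.
Qed.

Lemma fan_continuous U xi : continuous (fan U) xi.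
Proof.
  unfold fan.
  apply (continuous_comp_2 (fun xi => fst U * exp ((vel U - c - xi) / c))
    (fun xi => fst U * exp ((vel U - c - xi) / c) * (xi + c))
    (fun x y => (x, y))).
  - apply (ex_derive_continuous
      (fun xi : R => fst U * exp ((vel U - c - xi) / c))); auto_derive; lra.
  - apply (ex_derive_continuous
     (fun xi : R => fst U * exp ((vel U - c - xi) / c) * (xi + c)));
    auto_derive; lra.
  - apply continuous_ext with (fun p => p).
    intros []; reflexivity. apply continuous_id.
Qed.

Lemma fan_rarefaction w Ua Ub : physical Ua -> physical Ub ->
  fst Ub <= fst Ua -> vel Ub = curve_vel Ua (fst Ub) ->
  (forall xi, vel Ua - c <= xi <= vel Ub - c -> w xi = fan Ua xi) ->
  rarefaction c One w Ua Ub (vel Ua - c) (vel Ub - c).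
Proof.
  intros Pa Pb Hle Hv Hw.
  assert (vel Ua <= vel Ub).
  { rewrite Hv; unfold curve_vel.
    assert (phi (fst Ua) (fst Ub) <= phi (fst Ua) (fst Ua))
      by (apply phi_incr_le; assumption).
    rewrite phi_self in H by assumption. nra. }
  split; [lra |]. split. rewrite Hw by lra; apply fan_self, Pa.
  split. rewrite Hw by lra; apply fan_at_end; assumption.
  split. { intros xi Hxi. simpl. rewrite Hw by assumption. fold (vel (fan Ua xi)).
           rewrite vel_fan by assumption; ring. }
  split.
  - intros xi Hxi. rewrite Hw by assumption.
    apply filterlim_ext_loc with (fan Ua).
    + unfold within; apply filter_forall; intros y Hy; symmetry; apply Hw, Hy.
    + eapply filterlim_filter_le_1, fan_continuous.
      apply filter_le_within.
  - intros xi Hxi.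
    assert (L : locally xi (fun y => fan Ua y = w y)).
    { assert (K : open (fun y => vel Ua - c < y < vel Ub - c)).
      { apply open_and; [apply open_gt | apply open_lt]. }
      generalize (K xi Hxi); apply filter_imp; intros y Hy.
      symmetry; apply Hw; lra. }
    set (r := fun y => fst Ua * exp ((vel Ua - c - y) / c)).
    exists (- r xi / c).
    split; [| split].
    + apply is_derive_ext_loc with r.
      revert L; apply filter_imp; intros y Hy; rewrite <- Hy; reflexivity.
      unfold r; auto_derive; [lra | unfold Rminus, Rdiv; field; lra].
    + apply is_derive_ext_loc with (fun y => r y * (y + c)).
      revert L; apply filter_imp; intros y Hy; rewrite <- Hy; reflexivity.
      unfold r; auto_derive; [lra | unfold Rminus, Rdiv; field; lra].
    + apply is_derive_ext_loc with (fun y => r y * ((y + c) ^ 2 + c ^ 2)).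
      revert L; apply filter_imp; intros y Hy; rewrite <- Hy.
      assert (0 < r y) by (apply Rmult_lt_0_compat; [exact Pa | apply exp_pos]).
      unfold momentum_flux, fan; simpl; fold (r y). field; lra.
      unfold r; auto_derive; [lra | unfold Rminus, Rdiv; field; lra].
Qed.

(** In a fan [q = rho * (xi + c)]; differentiating and comparing with [q' = xi * rho']
    leaves [rho' = - rho / c], so that [rho * exp (xi / c)] is constant.  Only one-sided
    continuity is available at the ends: the mean value theorem is applied to a function
    of the clamped variable [cl]. *)
Lemma rarefaction_One_inv w Ua Ub a b :
  (forall xi, physical (w xi)) ->
  rarefaction c One w Ua Ub a b ->
  a = vel Ua - c /\ b = vel Ub - c /\ fst Ub <= fst Ua /\
  vel Ub = curve_vel Ua (fst Ub) /\
  (forall xi, a <= xi <= b -> w xi = fan Ua xi).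
Proof.
  intros Hw (Hab & Ha & Hb & He & Hc & Hd).
  assert (Ea : a = vel Ua - c).
  { rewrite <- Ha; generalize (He a); simpl; unfold vel; lra. }
  assert (Eb : b = vel Ub - c).
  { rewrite <- Hb; generalize (He b); simpl; unfold vel; lra. }
  assert (Pa : physical Ua) by (rewrite <- Ha; apply Hw).
  set (h := fun y => fst (w y) * exp (y / c)).
  set (cl := fun y => Rmax a (Rmin b y)).
  assert (cl_in : forall y, a <= cl y <= b).
  { intros y; unfold cl, Rmax, Rmin.
    destruct (Rle_dec b y), (Rle_dec a _); lra. }
  assert (cl_id : forall y, a <= y <= b -> cl y = y).
  { intros y Hy; unfold cl; rewrite Rmin_right, Rmax_right; lra. }
  assert (Hconst : forall xi, a <= xi <= b -> h xi = h a).
  { intros xi Hxi.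
    destruct (MVT_gen (fun y => h (cl y)) a xi (fun _ => 0)) as (z & _ & Hz).
    - rewrite Rmin_left, Rmax_right by lra. intros x Hx.
      apply is_derive_ext_loc with h.
      { assert (K : open (fun y => a < y < xi)).
        { apply open_and; [apply open_gt | apply open_lt]. }
        generalize (K x Hx); apply filter_imp; intros y Hy.
        rewrite cl_id; [reflexivity | lra]. }
      destruct (Hd x) as (d & H1 & H2 & _); [lra |].
      assert (H2' : is_derive (fun y => snd (w y)) x
                (d * (x + c) + fst (w x) * 1)).
      { apply is_derive_ext_loc with (fun y => fst (w y) * (y + c)).
        - assert (K : open (fun y => a < y < b)).
          { apply open_and; [apply open_gt | apply open_lt]. }
          generalize (K x (conj (proj1 Hx) (Rlt_le_trans _ _ _ (proj2 Hx) (proj2 Hxi)))).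
          apply filter_imp; intros y Hy.
          assert (Ey := He y); simpl in Ey.
          generalize (Hw y); unfold physical; intros Py.
          rewrite (snd_vel (w y) (Hw y)). f_equal. unfold vel; lra.
        - apply (is_derive_mult (fun y => fst (w y)) (fun y => y + c)).
          exact H1. auto_derive; [easy | ring]. intros; apply Rmult_comm. }
      assert (E : x * d = d * (x + c) + fst (w x) * 1).
      { rewrite <- (is_derive_unique _ _ _ H2), <- (is_derive_unique _ _ _ H2').
        reflexivity. }
      replace 0 with (d * exp (x / c) + fst (w x) * (/ c * exp (x / c))).
      apply (is_derive_mult (fun y => fst (w y)) (fun y => exp (y / c))).
      exact H1. auto_derive; [lra | unfold Rdiv; field; lra]. intros; apply Rmult_comm.
      replace d with (- fst (w x) / c). field; lra.
      apply Rmult_eq_reg_r with c; [field_simplify; lra | lra].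
    - intros x _. apply continuity_pt_filterlim.
      apply (continuous_mult (fun y => fst (w (cl y))) (fun y => exp (cl y / c))).
      + apply (filterlim_comp _ _ _ (fun y => w (cl y)) fst _ (locally (w (cl x)))).
        2: apply continuous_fst.
        apply (filterlim_comp _ _ _ cl w _ (within (fun y => a <= y <= b) (locally (cl x)))).
        2: apply Hc, cl_in.
        intros A HA.
        assert (Hcl : continuous cl x).
        { apply continuity_pt_filterlim.
          apply (continuity_pt_comp (Rmin b) (Rmax a)).
          apply continuity_Rmin. apply continuity_Rmax. }
        generalize (Hcl _ HA); unfold filtermap, within.
        apply filter_imp; intros y Hy; apply Hy, cl_in.
      + apply continuity_pt_filterlim.
        apply (continuity_pt_comp cl (fun y => exp (y / c))).
        * apply (continuity_pt_comp (Rmin b) (Rmax a)).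
          apply continuity_Rmin. apply continuity_Rmax.
        * apply continuity_pt_derivable; auto_derive; lra.
    - rewrite !cl_id in Hz; lra. }
  assert (Hfan : forall xi, a <= xi <= b -> w xi = fan Ua xi).
  { intros xi Hxi.
    assert (Er : fst (w xi) = fst Ua * exp ((vel Ua - c - xi) / c)).
    { generalize (Hconst xi Hxi); unfold h. rewrite Ha, <- Ea.
      intros E. replace ((a - xi) / c) with (a / c + - (xi / c)) by (field; lra).
      rewrite exp_plus, exp_Ropp.
      assert (0 < exp (xi / c)) by apply exp_pos.
      rewrite <- Rmult_assoc, <- E. field; lra. }
    apply state_eq; unfold fan; simpl; rewrite <- Er; [reflexivity |].
    rewrite (snd_vel _ (Hw xi)); f_equal.
    generalize (He xi Hxi); simpl; unfold vel; lra. }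
  assert (Ub = fan Ua b) by (rewrite <- Hb; apply Hfan; lra).
  destruct (fan_curve Ua b Pa) as [K1 K2]; [lra |].
  rewrite <- H in K1, K2.
  repeat split; try assumption.
  unfold curve_vel; rewrite K2. rewrite Eb. field; lra.
Qed.

(** Fans and shocks are treated at once from here on: which of the two occurs is read off
    from the densities, a fan lowering the density and a shock raising it. *)
Lemma wave_One_inv w Ua Ub a b :
  (forall xi, physical (w xi)) -> physical Ua -> physical Ub ->
  wave c One w Ua Ub a b ->
  vel Ub = curve_vel Ua (fst Ub) /\
  a = start_speed Ua (fst Ub) /\ b = end_speed Ua (fst Ub) /\ a <= b /\
  (forall xi, a < xi < b -> w xi = fan Ua xi) /\
  (fst Ub <= fst Ua -> w b = Ub).
Proof.
  intros Hw Pa Pb [H | [-> H]].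
  - assert (a <= b) by apply H.
    assert (w b = Ub) by apply H.
    apply rarefaction_One_inv in H; [| exact Hw].
    destruct H as (Ea & Eb & Hle & Hv & Hf).
    split; [exact Hv |]. unfold start_speed.
    destruct (Rle_dec (fst Ub) (fst Ua)); [| lra].
    split; [exact Ea |]. split.
    { rewrite Eb, Hv; unfold curve_vel, end_speed.
      rewrite phi_le, psi_le by (unfold physical in *; lra). ring. }
    split; [assumption |]. split; [intros; apply Hf; lra | auto].
  - apply shock_One_iff in H; try assumption.
    destruct H as (H1 & H2 & H3).
    split; [exact H2 |]. unfold start_speed.
    destruct (Rle_dec (fst Ub) (fst Ua)); [lra |].
    repeat split; try assumption; try lra. intros; lra. 
Qed.

Lemma wave_One_intro w Ua Ub : physical Ua -> physical Ub ->
  vel Ub = curve_vel Ua (fst Ub) ->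
  (forall xi, start_speed Ua (fst Ub) <= xi <= end_speed Ua (fst Ub) ->
    w xi = fan Ua xi) ->
  wave c One w Ua Ub (start_speed Ua (fst Ub)) (end_speed Ua (fst Ub)).
Proof.
  intros Pa Pb Hv. unfold start_speed.
  destruct (Rle_dec (fst Ub) (fst Ua)); intros Hw.
  - left. assert (E : end_speed Ua (fst Ub) = vel Ub - c).
    { rewrite Hv; unfold curve_vel, end_speed.
      rewrite phi_le, psi_le by (unfold physical in *; lra). ring. }
    rewrite E in *. apply fan_rarefaction; assumption.
  - right; split; [reflexivity |]. apply shock_One_iff; try assumption.
    repeat split; lra.
Qed.

Lemma start_le_end U x : physical U -> 0 < x -> start_speed U x <= end_speed U x.
Proof.
  unfold physical; intros P Hx; unfold start_speed.
  destruct (Rle_dec x (fst U)); [| lra].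
  unfold end_speed. assert (psi (fst U) x <= 1); [| nra].
  rewrite <- (psi_self (fst U)) by lra.
  destruct r as [r | ->]; [left; apply psi_incr; lra | lra].
Qed.

End Waves.

(** * The Riemann problem and its left traces *)

Section Riemann.
Variable c : R.
Hypothesis c_pos : 0 < c.

Lemma vel_mirror U : vel (mirror U) = - vel U.
Proof. unfold vel; simpl; unfold Rdiv; ring. Qed.

Lemma phi_lt_psi a x : 0 < a -> 0 < x -> phi a x < psi a x.
Proof.
  intros Ha Hx. destruct (Rle_or_lt x a).
  - rewrite psi_le, phi_le; lra.
  - rewrite phi_shock by lra.
    destruct (sqrt_mult_pos a x) as [Hk _]; try lra.
    assert (0 < a / sqrt (a * x)) by (apply Rdiv_lt_0_compat; lra). lra.
Qed.

(** A 1-wave moves more slowly than the gas behind it, and by reflection a 2-wave moves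
    faster: this separates the two waves of a Riemann solution. *)
Lemma end_lt_curve_vel U x : physical U -> 0 < x ->
  end_speed c U x < curve_vel c U x.
Proof.
  intros P Hx; unfold end_speed, curve_vel.
  assert (phi (fst U) x < psi (fst U) x) by (apply phi_lt_psi; assumption). nra.
Qed.

Lemma curve_vel_decr U x y : physical U -> 0 < x -> x < y ->
  curve_vel c U y < curve_vel c U x.
Proof.
  intros P Hx Hy; unfold curve_vel.
  assert (phi (fst U) x < phi (fst U) y) by (apply phi_incr; assumption). nra.
Qed.

Lemma curve_vel_self U : physical U -> curve_vel c U (fst U) = vel U.
Proof. intros; unfold curve_vel; rewrite phi_self by assumption; ring. Qed.

(** [x] is the density between the two waves: both wave curves give it the same
    velocity, the 2-wave being the mirror image of a 1-wave issued from the right state. *)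
Definition middle (Ua Ub : state) (x : R) : Prop :=
  0 < x /\ curve_vel c Ua x + curve_vel c (mirror Ub) x = 0.

Definition middle_state (Ua : state) (x : R) : state := (x, x * curve_vel c Ua x).

Definition fan2 (U : state) (xi : R) : state := mirror (fan c (mirror U) (- xi)).

(** The values of a solution away from the four speeds that bound its waves. *)
Definition profile (Ua Ub : state) (x : R) (w : R -> state) : Prop :=
  (forall xi, xi < start_speed c Ua x -> w xi = Ua) /\
  (forall xi, start_speed c Ua x < xi < end_speed c Ua x -> w xi = fan c Ua xi) /\
  (forall xi, end_speed c Ua x < xi < - end_speed c (mirror Ub) x ->
    w xi = middle_state Ua x) /\
  (forall xi, - end_speed c (mirror Ub) x < xi < - start_speed c (mirror Ub) x ->
    w xi = fan2 Ub xi) /\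
  (forall xi, - start_speed c (mirror Ub) x < xi -> w xi = Ub).

(** Both curves lose velocity strictly when the density grows. *)
Lemma middle_unique Ua Ub x y : physical Ua -> physical Ub ->
  middle Ua Ub x -> middle Ua Ub y -> x = y.
Proof.
  intros Pa Pb [Hx Ex] [Hy Ey].
  assert (G : forall s t, 0 < s -> s < t ->
    curve_vel c Ua t + curve_vel c (mirror Ub) t <
    curve_vel c Ua s + curve_vel c (mirror Ub) s).
  { intros s t Hs Ht.
    assert (curve_vel c Ua t < curve_vel c Ua s) by (apply curve_vel_decr; assumption).
    assert (curve_vel c (mirror Ub) t < curve_vel c (mirror Ub) s)
      by (apply curve_vel_decr; assumption). lra. }
  destruct (Rtotal_order x y) as [K | [K | K]]; [| exact K |].
  - generalize (G x y Hx K); lra.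
  - generalize (G y x Hy K); lra.
Qed.

Lemma middle_speeds Ua Ub x : physical Ua -> physical Ub -> middle Ua Ub x ->
  start_speed c Ua x <= end_speed c Ua x < - end_speed c (mirror Ub) x /\
  - end_speed c (mirror Ub) x <= - start_speed c (mirror Ub) x.
Proof.
  intros Pa Pb [Hx Ex].
  assert (start_speed c Ua x <= end_speed c Ua x) by (apply start_le_end; assumption).
  assert (start_speed c (mirror Ub) x <= end_speed c (mirror Ub) x)
    by (apply start_le_end; assumption).
  assert (end_speed c Ua x < curve_vel c Ua x) by (apply end_lt_curve_vel; assumption).
  assert (end_speed c (mirror Ub) x < curve_vel c (mirror Ub) x)
    by (apply end_lt_curve_vel; assumption).
  lra.
Qed.

Lemma euler_profile Ua Ub w : physical Ua -> physical Ub ->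
  euler_riemann c Ua Ub w -> exists x, middle Ua Ub x /\ profile Ua Ub x w.
Proof.
  intros Pa Pb (Hw & Um & a1 & b1 & a2 & b2 & Pm & W1 & W2 & Hlt & E1 & E2 & E3).
  apply wave_One_inv in W1; try assumption.
  apply mirror_wave in W2; simpl in W2.
  apply wave_One_inv in W2; try assumption.
  2: intros xi; apply mirror_physical, Hw.
  destruct W1 as (V1 & A1 & B1 & L1 & F1 & _).
  destruct W2 as (V2 & A2 & B2 & L2 & F2 & _).
  change (fst (mirror Um)) with (fst Um) in *. rewrite vel_mirror in V2.
  exists (fst Um). split. split; [exact Pm | lra].
  unfold profile.
  rewrite <- B1, <- B2, <- A1, <- A2, !Ropp_involutive.
  split; [exact E1 |]. split; [exact F1 |].
  split; [| split; [| exact E3]].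
  - intros xi Hxi. rewrite E2 by exact Hxi.
    apply state_eq; [reflexivity |]. simpl. rewrite <- V1; apply snd_vel, Pm.
  - intros xi Hxi. unfold fan2. rewrite <- F2 by lra.
    symmetry; apply mirror_profileK.
Qed.

Lemma euler_unique Ua Ub w w' : physical Ua -> physical Ub ->
  euler_riemann c Ua Ub w -> euler_riemann c Ua Ub w' -> eq_off_finite w w'.
Proof.
  intros Pa Pb H H'.
  destruct (euler_profile _ _ _ Pa Pb H) as (x & M & E1 & E2 & E3 & E4 & E5).
  destruct (euler_profile _ _ _ Pa Pb H') as (y & M' & K1 & K2 & K3 & K4 & K5).
  assert (y = x) by (apply (middle_unique Ua Ub); assumption). subst y.
  exists (start_speed c Ua x :: end_speed c Ua x :: - end_speed c (mirror Ub) x ::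
    - start_speed c (mirror Ub) x :: nil).
  intros xi Hxi; simpl in Hxi.
  destruct (Rtotal_order xi (start_speed c Ua x)) as [G1 | [G1 | G1]];
    [rewrite E1, K1 by assumption; reflexivity | now exfalso; apply Hxi; auto |].
  destruct (Rtotal_order xi (end_speed c Ua x)) as [G2 | [G2 | G2]];
    [rewrite E2, K2 by lra; reflexivity | now exfalso; apply Hxi; auto |].
  destruct (Rtotal_order xi (- end_speed c (mirror Ub) x)) as [G3 | [G3 | G3]];
    [rewrite E3, K3 by lra; reflexivity | now exfalso; apply Hxi; auto |].
  destruct (Rtotal_order xi (- start_speed c (mirror Ub) x)) as [G4 | [G4 | G4]];
    [rewrite E4, K4 by lra; reflexivity | now exfalso; apply Hxi; auto 6 |].
  rewrite E5, K5 by lra; reflexivity.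
Qed.

Lemma euler_exists Ua Ub x : physical Ua -> physical Ub -> middle Ua Ub x ->
  exists w, euler_riemann c Ua Ub w /\ profile Ua Ub x w.
Proof.
  intros Pa Pb M. destruct (middle_speeds _ _ _ Pa Pb M) as [L12 L3].
  destruct M as [Hx Ex].
  set (a1 := start_speed c Ua x) in *. set (b1 := end_speed c Ua x) in *.
  set (a2 := - end_speed c (mirror Ub) x) in *.
  set (b2 := - start_speed c (mirror Ub) x) in *.
  set (w := fun xi => if Rlt_dec xi a1 then Ua else
    if Rle_dec xi b1 then fan c Ua xi else
    if Rlt_dec xi a2 then middle_state Ua x else
    if Rle_dec xi b2 then fan2 Ub xi else Ub).
  assert (Pm : physical (middle_state Ua x)) by exact Hx.
  assert (w1 : forall xi, xi < a1 -> w xi = Ua).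
  { intros xi Hxi; unfold w. destruct (Rlt_dec xi a1); [easy | lra]. }
  assert (w2 : forall xi, a1 <= xi <= b1 -> w xi = fan c Ua xi).
  { intros xi Hxi; unfold w. destruct (Rlt_dec xi a1); [lra |].
    destruct (Rle_dec xi b1); [easy | lra]. }
  assert (w3 : forall xi, b1 < xi < a2 -> w xi = middle_state Ua x).
  { intros xi Hxi; unfold w. destruct (Rlt_dec xi a1); [lra |].
    destruct (Rle_dec xi b1); [lra |].
    destruct (Rlt_dec xi a2); [easy | lra]. }
  assert (w4 : forall xi, a2 <= xi <= b2 -> w xi = fan2 Ub xi).
  { intros xi Hxi; unfold w. destruct (Rlt_dec xi a1); [lra |].
    destruct (Rle_dec xi b1); [lra |].
    destruct (Rlt_dec xi a2); [lra |].
    destruct (Rle_dec xi b2); [easy | lra]. }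
  assert (w5 : forall xi, b2 < xi -> w xi = Ub).
  { intros xi Hxi; unfold w. destruct (Rlt_dec xi a1); [lra |].
    destruct (Rle_dec xi b1); [lra |].
    destruct (Rlt_dec xi a2); [lra |].
    destruct (Rle_dec xi b2); [lra | easy]. }
  assert (Vm : vel (middle_state Ua x) = curve_vel c Ua x).
  { unfold vel; simpl; field; lra. }
  exists w. split.
  - split.
    { intros xi; unfold w. destruct (Rlt_dec xi a1); [exact Pa |].
      destruct (Rle_dec xi b1); [apply fan_physical, Pa |].
      destruct (Rlt_dec xi a2); [exact Pm |].
      destruct (Rle_dec xi b2); [| exact Pb].
      apply mirror_physical, fan_physical, mirror_physical, Pb. }
    exists (middle_state Ua x), a1, b1, a2, b2.
    split; [exact Pm |]. split.
    { apply (wave_One_intro c c_pos w Ua (middle_state Ua x)); assumption. }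
    split.
    { replace a2 with (- - a2) by ring; replace b2 with (- - b2) by ring.
      assert (K : wave c One (mirror_profile w) (mirror Ub)
        (mirror (middle_state Ua x)) (- b2) (- a2)).
      { unfold a2, b2; rewrite !Ropp_involutive.
        apply (wave_One_intro c c_pos (mirror_profile w) (mirror Ub)
          (mirror (middle_state Ua x))); try assumption.
        - rewrite vel_mirror, Vm; simpl; lra.
        - simpl; intros xi Hxi. unfold mirror_profile. rewrite w4.
          unfold fan2; rewrite mirrorK, Ropp_involutive; reflexivity.
          unfold a2, b2; lra. }
      apply mirror_wave in K. rewrite !mirrorK in K. simpl in K.
      revert K.
      unfold wave, rarefaction; intros [K | K]; [left | right; exact K].
      destruct K as (K1 & K2 & K3 & K4 & K5 & K6).
      split; [exact K1 |]. split; [rewrite <- K2; symmetry; apply mirror_profileK |].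
      split; [rewrite <- K3; symmetry; apply mirror_profileK |].
      split; [intros xi Hxi; rewrite <- (mirror_profileK w xi); apply K4, Hxi |].
      split.
      - intros xi Hxi. rewrite <- (mirror_profileK w xi).
        apply filterlim_ext with (mirror_profile (mirror_profile w)).
        apply mirror_profileK. apply K5, Hxi.
      - intros xi Hxi. destruct (K6 xi Hxi) as (d & D1 & D2 & D3).
        exists d. split; [| split].
        revert D1; apply is_derive_ext; intros; rewrite mirror_profileK; easy.
        revert D2; apply is_derive_ext; intros; rewrite mirror_profileK; easy.
        revert D3; apply is_derive_ext; intros; rewrite mirror_profileK; easy. }
    repeat split; try assumption; lra.
  - split; [exact w1 |]. split; [intros; apply w2; unfold a1, b1; lra |].
    split; [exact w3 |]. split; [intros; apply w4; unfold a2, b2; lra |].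
    exact w5.
Qed.

(** States that can be the left trace on [xi = 0] of a solution issued from [UL]. *)
Definition trace (UL U : state) : Prop :=
  exists W, euler_riemann c UL U W /\ filterlim W (at_left 0) (locally U).

Lemma at_left_near d : d < 0 -> at_left 0 (fun xi => d < xi < 0).
Proof.
  intros Hd. unfold at_left, within.
  assert (K : locally 0 (fun xi => d < xi)) by (apply open_gt; exact Hd).
  revert K; apply filter_imp; intros xi; lra.
Qed.

(** Left limits at 0 are computed by replacing the profile with a continuous function [G]
    that agrees with it just before 0. *)
Lemma left_limit_intro (W G : R -> state) d : d < 0 ->
  (forall xi, d < xi < 0 -> W xi = G xi) -> continuous G 0 ->
  filterlim W (at_left 0) (locally (G 0)).
Proof.
  intros Hd HW HG.
  apply filterlim_ext_loc with G.
  - generalize (at_left_near d Hd); apply filter_imp; intros xi Hxi.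
    symmetry; apply HW, Hxi.
  - eapply filterlim_filter_le_1, HG. apply filter_le_within.
Qed.

Lemma left_limit_unique (W G : R -> state) d U : d < 0 ->
  (forall xi, d < xi < 0 -> W xi = G xi) -> continuous G 0 ->
  filterlim W (at_left 0) (locally U) -> U = G 0.
Proof.
  intros Hd HW HG HU.
  apply (@filterlim_locally_unique R R_AbsRing
    (prod_NormedModule R_AbsRing R_NormedModule R_NormedModule) (at_left 0) _ W).
  - exact HU.
  - apply left_limit_intro with d; assumption.
Qed.

Lemma fan2_continuous U xi : continuous (fan2 U) xi.
Proof.
  unfold fan2.
  apply (continuous_comp (fun xi => fan c (mirror U) (- xi)) mirror).
  2: apply mirror_continuous.
  apply (continuous_comp Ropp (fan c (mirror U))).
  2: apply fan_continuous.
  apply (ex_derive_continuous (fun x : R => - x)); auto_derive; easy.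
Qed.

Lemma end_speed_rarefaction U x : physical U -> x <= fst U ->
  end_speed c U x = curve_vel c U x - c.
Proof.
  intros P Hx; unfold end_speed, curve_vel.
  rewrite psi_le, phi_le by assumption; ring.
Qed.

Lemma start_speed_rarefaction U x : x <= fst U -> start_speed c U x = vel U - c.
Proof. intros H; unfold start_speed; destruct (Rle_dec x (fst U)); lra. Qed.

Lemma end_speed_self U : physical U -> end_speed c U (fst U) = vel U - c.
Proof.
  intros P; rewrite end_speed_rarefaction, curve_vel_self; [reflexivity | | | lra];
    assumption.
Qed.

Lemma start_speed_shock U x : fst U < x -> start_speed c U x = end_speed c U x.
Proof. intros H; unfold start_speed; destruct (Rle_dec x (fst U)); lra. Qed.

(** In the three cases no wave, a 1-wave only, or a 2-wave ends at the trace.  A shock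
    standing at speed 0 is excluded, since it would put the limit on its other side. *)
Lemma trace_inv UL U : physical UL -> physical U -> trace UL U ->
  (U = UL /\ c <= vel UL) \/
  (vel U = curve_vel c UL (fst U) /\ end_speed c UL (fst U) <= 0 /\
    (fst UL < fst U -> end_speed c UL (fst U) < 0)) \/
  (exists x, middle UL U x /\ end_speed c UL x < 0 /\
    0 <= start_speed c (mirror U) x /\ end_speed c UL x < - end_speed c (mirror U) x <= 0 /\
    (fst U < x -> 0 < start_speed c (mirror U) x)).
Proof.
  intros PL P (W & HW & Hlim).
  destruct (euler_profile _ _ _ PL P HW) as (x & M & E1 & E2 & E3 & E4 & E5).
  destruct (middle_speeds _ _ _ PL P M) as [L12 L3].
  destruct (Rle_or_lt 0 (start_speed c UL x)) as [G1 | G1].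
  { left. assert (U = UL).
    { apply (left_limit_unique W (fun _ => UL) (-1)); try assumption; try lra.
      intros; apply E1; lra. apply continuous_const. }
    subst U; split; [reflexivity |].
    assert (x = fst UL).
    { apply (middle_unique UL UL); try assumption. split; [exact P |].
      rewrite curve_vel_self by assumption.
      change (fst UL) with (fst (mirror UL)).
      rewrite curve_vel_self, vel_mirror by assumption; lra. }
    subst x; rewrite start_speed_rarefaction in G1; lra. }
  destruct (Rle_or_lt 0 (end_speed c UL x)) as [G2 | G2].
  { right; left.
    destruct (Rle_or_lt x (fst UL)) as [Hx | Hx].
    2: { rewrite start_speed_shock in G1; lra. }
    rewrite start_speed_rarefaction in G1 by assumption.
    assert (E : U = fan c UL 0).
    { apply (left_limit_unique W (fan c UL) (vel UL - c)); try assumption; try lra.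
      intros; apply E2. rewrite start_speed_rarefaction by assumption; lra.
      apply fan_continuous. }
    destruct (fan_curve c c_pos UL 0 PL) as [K1 K2]; [lra |].
    assert (K3 := vel_fan c UL 0 PL). rewrite <- E in K1, K2, K3.
    assert (K4 : vel U = curve_vel c UL (fst U)).
    { unfold curve_vel; rewrite K2, K3; field; lra. }
    split; [exact K4 |].
    rewrite end_speed_rarefaction by assumption. lra. }
  destruct (Rle_or_lt 0 (- end_speed c (mirror U) x)) as [G3 | G3].
  { right; left.
    assert (E : U = middle_state UL x).
    { apply (left_limit_unique W (fun _ => middle_state UL x) (end_speed c UL x));
        try assumption.
      intros; apply E3; lra. apply continuous_const. }
    assert (Ex : fst U = x) by (rewrite E; reflexivity).
    assert (Ev : vel U = curve_vel c UL x).
    { rewrite E; unfold vel; simpl; destruct M; field; lra. }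
    rewrite Ex; repeat split; lra. }
  right; right. exists x. split; [exact M |]. split; [exact G2 |].
  destruct (Rle_or_lt 0 (- start_speed c (mirror U) x)) as [G4 | G4].
  - destruct (Rle_or_lt x (fst U)) as [Hx | Hx].
    2: { rewrite start_speed_shock in G4 by exact Hx. lra. }
    assert (E : U = fan2 U 0).
    { apply (left_limit_unique W (fan2 U) (- end_speed c (mirror U) x));
        try assumption.
      intros; apply E4; lra. apply fan2_continuous. }
    assert (K := vel_fan c (mirror U) (- 0) P).
    rewrite <- (mirrorK (fan c (mirror U) (- 0))) in K.
    fold (fan2 U 0) in K. rewrite <- E in K.
    rewrite start_speed_rarefaction by exact Hx. repeat split; lra.
  - repeat split; lra.
Qed.

Lemma trace_self UL : physical UL -> c <= vel UL -> trace UL UL.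
Proof.
  intros P H.
  assert (M : middle UL UL (fst UL)).
  { split; [exact P |]. rewrite curve_vel_self by assumption.
    change (fst UL) with (fst (mirror UL)).
    rewrite curve_vel_self, vel_mirror by assumption; lra. }
  destruct (euler_exists _ _ _ P P M) as (W & HW & E1 & _).
  exists W; split; [exact HW |].
  apply (left_limit_intro W (fun _ => UL) (-1)); [lra | | apply continuous_const].
  intros; apply E1. rewrite start_speed_rarefaction; lra.
Qed.

Lemma trace_curve UL U : physical UL -> physical U ->
  vel U = curve_vel c UL (fst U) -> end_speed c UL (fst U) < 0 -> - c <= vel U ->
  trace UL U.
Proof.
  intros PL P H He Hc.
  assert (M : middle UL U (fst U)).
  { split; [exact P |]. rewrite <- H.
    change (fst U) with (fst (mirror U)).
    rewrite curve_vel_self, vel_mirror by assumption; lra. }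
  destruct (euler_exists _ _ _ PL P M) as (W & HW & E1 & E2 & E3 & _).
  exists W; split; [exact HW |].
  assert (E : middle_state UL (fst U) = U).
  { apply state_eq; [reflexivity |]. simpl. rewrite <- H, <- snd_vel; easy. }
  rewrite <- E.
  apply (left_limit_intro W (fun _ => middle_state UL (fst U))
    (end_speed c UL (fst U))); [exact He | | apply continuous_const].
  intros; apply E3.
  assert (K := end_speed_self (mirror U) P). simpl in K.
  rewrite vel_mirror in K. lra.
Qed.

(** The middle density [x] decides whether the 2-wave is a fan or a shock; a shock has to
    move strictly away from the particle for its right side to be the trace. *)
Lemma trace_two UL U x : physical UL -> physical U -> middle UL U x ->
  0 <= start_speed c (mirror U) x ->
  (fst U < x -> 0 < start_speed c (mirror U) x) -> trace UL U.
Proof.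
  intros PL P M Hs Hshock.
  destruct (middle_speeds _ _ _ PL P M) as [L12 L3].
  destruct (euler_exists _ _ _ PL P M) as (W & HW & E1 & E2 & E3 & E4 & E5).
  exists W; split; [exact HW |].
  destruct (Rle_lt_or_eq_dec _ _ Hs) as [G | G].
  { apply (left_limit_intro W (fun _ => U) (- start_speed c (mirror U) x));
      [lra | | apply continuous_const].
    intros; apply E5; lra. }
  destruct (Rle_or_lt x (fst U)) as [Hx | Hx]; [| specialize (Hshock Hx); lra].
  destruct L3 as [L3 | L3].
  - (* the fan is not trivial and ends at speed 0, so the limit is its last state *)
    assert (E : fan2 U 0 = U).
    { rewrite start_speed_rarefaction in G by exact Hx.
      rewrite vel_mirror in G.
      unfold fan2. replace (- 0) with (vel (mirror U) - c) by (rewrite vel_mirror; lra).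
      rewrite fan_self by assumption. apply mirrorK. }
    rewrite <- E.
    apply (left_limit_intro W (fan2 U) (- end_speed c (mirror U) x));
      [lra | | apply fan2_continuous].
    intros; apply E4; lra.
  - (* the 2-wave has zero width, so the limit is the middle state *)
    destruct M as [M1 M2].
    assert (Ex : x = fst U).
    { assert (Hx' := Hx); destruct Hx as [Hx | Hx]; [exfalso | exact Hx].
      rewrite start_speed_rarefaction in L3 by exact Hx'.
      unfold end_speed in L3.
      assert (K : psi (fst (mirror U)) x < psi (fst (mirror U)) (fst U))
        by (apply psi_incr; assumption).
      assert (K' := psi_self (fst (mirror U)) P).
      simpl in K, K', L3. nra. }
    subst x.
    assert (E : middle_state UL (fst U) = U).
    { apply state_eq; [reflexivity |]. simpl.
      assert (K := curve_vel_self (mirror U) P). simpl in K.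
      rewrite K, vel_mirror in M2.
      rewrite snd_vel by assumption. f_equal; lra. }
    rewrite <- E.
    apply (left_limit_intro W (fun _ => middle_state UL (fst U))
      (end_speed c UL (fst U))); [lra | | apply continuous_const].
    intros; apply E3; lra.
Qed.

End Riemann.

(** * Inverting a decreasing function *)

Lemma ivt f a b y : a <= b -> (forall x, a <= x <= b -> continuity_pt f x) ->
  (f a <= y <= f b \/ f b <= y <= f a) -> exists x, a <= x <= b /\ f x = y.
Proof.
  intros Hab Hc H.
  destruct (Req_dec (f a) y) as [E | E]; [exists a; split; [lra | exact E] |].
  destruct (Req_dec (f b) y) as [E' | E']; [exists b; split; [lra | exact E'] |].
  assert (a < b). { destruct Hab as [K | ->]; [exact K |]. destruct H; lra. }
  assert (Hy : forall x, continuity_pt (fun _ => y) x)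
    by (intros; apply continuity_pt_const; now intros ? ?).
  destruct H as [H | H].
  - destruct (IVT_interv (fun x => f x - y) a b) as (x & Hx & Ex); try lra.
    intros x Hx; apply (continuity_pt_minus f); auto.
    exists x; split; [exact Hx | lra].
  - destruct (IVT_interv (fun x => y - f x) a b) as (x & Hx & Ex); try lra.
    intros x Hx; apply (continuity_pt_minus (fun _ => y)); auto.
    exists x; split; [exact Hx | lra].
Qed.

(** Clamping at [f a] makes the inverse of a decreasing function total. *)
Definition decr_inverse (f : R -> R) (a y : R) : R :=
  epsilon (inhabits 0) (fun x => a <= x /\ f x = Rmin y (f a)).

Section DecrInverse.
Variables (f : R -> R) (a : R).
Hypothesis f_cont : forall x, a <= x -> continuity_pt f x.
Hypothesis f_decr : forall x y, a <= x -> x < y -> f y < f x.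
Hypothesis f_unbounded : forall y, exists x, a <= x /\ f x <= y.
Notation g := (decr_inverse f a).

Lemma decr_inverse_spec y : a <= g y /\ f (g y) = Rmin y (f a).
Proof.
  unfold decr_inverse; apply epsilon_spec.
  destruct (f_unbounded (Rmin y (f a))) as (b & Hb & Eb).
  destruct (ivt f a b (Rmin y (f a)) Hb) as (x & Hx & Ex).
  - intros x Hx; apply f_cont; lra.
  - right; split; [exact Eb | apply Rmin_r].
  - exists x; split; [lra | exact Ex].
Qed.

Lemma decr_inverse_le x y : a <= x -> f x <= y -> g y <= x.
Proof.
  intros Hx Hy. destruct (decr_inverse_spec y) as [G E].
  apply Rnot_lt_le; intros K. generalize (f_decr x (g y) Hx K).
  rewrite E. unfold Rmin; destruct (Rle_dec y (f a)); [lra |].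
  destruct Hx as [Hx | <-]; [generalize (f_decr a x); lra | lra].
Qed.

Lemma decr_inverse_lt x y : a <= x -> f x < y -> a < x -> g y < x.
Proof.
  intros Hx Hy Hax. destruct (decr_inverse_le x y Hx) as [K | K]; [lra | exact K |].
  destruct (decr_inverse_spec y) as [_ E]. rewrite K in E.
  generalize (f_decr a x). unfold Rmin in E; destruct (Rle_dec y (f a)); lra.
Qed.

Lemma decr_inverse_gt x y : a <= x -> y < f x -> x < g y.
Proof.
  intros Hx Hy. destruct (decr_inverse_spec y) as [G E].
  apply Rnot_le_lt; intros K.
  assert (f x <= f (g y)).
  { destruct K as [K | ->]; [left; apply f_decr; assumption | lra]. }
  generalize (Rmin_l y (f a)); lra.
Qed.

Lemma decr_inverse_ge x y : a <= x -> y <= f x -> x <= g y.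
Proof.
  intros Hx Hy. destruct (decr_inverse_spec y) as [G E].
  apply Rnot_lt_le; intros K.
  generalize (f_decr (g y) x G K) (Rmin_l y (f a)); lra.
Qed.

Lemma decr_inverse_left x : a <= x -> g (f x) = x.
Proof.
  intros Hx; apply Rle_antisym.
  apply decr_inverse_le; lra. apply decr_inverse_ge; lra.
Qed.

Lemma decr_inverse_right y : y <= f a -> f (g y) = y.
Proof. intros H; destruct (decr_inverse_spec y) as [_ E]; now rewrite Rmin_left in E. Qed.

Lemma decr_inverse_decr y z : y <= z -> g z <= g y.
Proof.
  intros H. destruct (decr_inverse_spec y) as [G E].
  apply decr_inverse_le; [exact G |]. generalize (Rmin_l y (f a)); lra.
Qed.

(** The order comparisons above bound the inverse on both sides. *)
Lemma decr_inverse_continuous y : continuity_pt g y.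
Proof.
  destruct (decr_inverse_spec y) as [G E].
  apply continuity_pt_filterlim, filterlim_locally. intros [eps Heps].
  change (locally y (fun z => Rabs (g z - g y) < eps)).
  assert (L1 : locally y (fun z => g z < g y + eps)).
  { assert (f (g y + eps) < y).
    { generalize (f_decr (g y) (g y + eps)) (Rmin_l y (f a)); lra. }
    assert (K : locally y (fun z => f (g y + eps) < z)) by (apply open_gt; assumption).
    revert K; apply filter_imp; intros z Hz; apply decr_inverse_lt; lra. }
  assert (L2 : locally y (fun z => g y - eps < g z)).
  { destruct (Rle_or_lt a (g y - eps)) as [K | K].
    - assert (y < f (g y - eps)).
      { assert (f (g y) < f (g y - eps)) by (apply f_decr; lra).
        assert (f (g y) < f a) by (apply f_decr; lra).
        unfold Rmin in E; destruct (Rle_dec y (f a)); lra. }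
      assert (L : locally y (fun z => z < f (g y - eps))) by (apply open_lt; assumption).
      revert L; apply filter_imp; intros z Hz; apply decr_inverse_gt; lra.
    - apply filter_forall; intros z. destruct (decr_inverse_spec z); lra. }
  generalize (filter_and _ _ L1 L2); apply filter_imp; intros z Hz.
  apply Rabs_def1; lra.
Qed.
End DecrInverse.

(** * Left traces of given flux *)

Section Curve.
Variable c : R.
Hypothesis c_pos : 0 < c.

(** The density at which the 1-wave from [U] ends with speed 0: the sonic point of the fan
    when [vel U <= c], the state behind the stationary shock otherwise. *)
Definition crit (U : state) : R :=
  if Rle_dec (vel U) c then fst U * exp (vel U / c - 1)
  else fst U * (vel U / c) ^ 2.

Lemma crit_sub U : physical U -> vel U <= c ->
  0 < crit U <= fst U /\ end_speed c U (crit U) = 0 /\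
  curve_mom c U (crit U) = c * crit U.
Proof.
  intros P H. unfold crit. destruct (Rle_dec (vel U) c); [| lra].
  unfold physical in P.
  set (e := vel U / c - 1). assert (0 < exp e) by apply exp_pos.
  assert (e <= 0).
  { assert (vel U / c <= 1); [| unfold e; lra].
    apply Rmult_le_reg_r with c; [lra | field_simplify; lra]. }
  assert (exp e <= 1).
  { rewrite <- exp_0. destruct H1 as [H1 | ->]; [left; apply exp_increasing, H1 | lra]. }
  assert (L : 0 < fst U * exp e <= fst U) by (split; nra).
  split; [exact L |].
  unfold end_speed, curve_mom, curve_vel.
  rewrite psi_le, phi_le by lra.
  rewrite ln_mult, ln_exp by lra.
  split; [| replace (vel U - _) with c; [ring |]]; unfold e; field; lra.
Qed.

(** The mass part of the Rankine-Hugoniot relations. *)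
Lemma shock_mom U x : physical U -> fst U <= x ->
  curve_mom c U x = snd U + end_speed c U x * (x - fst U).
Proof.
  intros P Hx. rewrite (snd_vel U P). unfold physical in P.
  unfold end_speed, curve_mom, curve_vel.
  rewrite phi_shock, psi_ge by lra.
  destruct (sqrt_mult_pos (fst U) x) as [Hk Hkk]; try lra.
  set (k := sqrt (fst U * x)) in *.
  replace x with (k * k / fst U) by (rewrite Hkk; field; lra). field; lra.
Qed.

Lemma crit_super U : physical U -> c < vel U ->
  fst U < crit U /\ end_speed c U (crit U) = 0 /\ curve_mom c U (crit U) = snd U.
Proof.
  intros P H. assert (P' := P). unfold physical in P.
  assert (L : fst U < crit U).
  { unfold crit. destruct (Rle_dec (vel U) c); [lra |].
    assert (1 < vel U / c).
    { apply Rmult_lt_reg_r with c; [lra | field_simplify; lra]. }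
    set (z := vel U / c) in *. assert (1 < z ^ 2) by nra. nra. }
  assert (E : end_speed c U (crit U) = 0).
  { unfold end_speed. rewrite psi_ge by lra.
    unfold crit; destruct (Rle_dec (vel U) c); [lra |].
    assert (0 < vel U / c) by (apply Rdiv_lt_0_compat; lra).
    replace (fst U * (fst U * (vel U / c) ^ 2)) with
      ((fst U * (vel U / c)) * (fst U * (vel U / c))) by ring.
    rewrite sqrt_mult_self by nra. field; lra. }
  split; [exact L | split; [exact E |]].
  rewrite shock_mom, E by (assumption || lra). ring.
Qed.

Lemma crit_pos U : physical U -> 0 < crit U.
Proof.
  intros P. destruct (Rle_or_lt (vel U) c) as [H | H].
  - apply (crit_sub U P H).
  - generalize (crit_super U P H); unfold physical in P; lra.
Qed.

Lemma crit_speed U : physical U -> end_speed c U (crit U) = 0.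
Proof.
  intros P. destruct (Rle_or_lt (vel U) c) as [H | H].
  - apply (crit_sub U P H).
  - apply (crit_super U P H).
Qed.

Definition crit_mom (U : state) : R := curve_mom c U (crit U).

Lemma crit_mom_pos U : physical U -> 0 < crit_mom U.
Proof.
  intros P; unfold crit_mom. destruct (Rle_or_lt (vel U) c) as [H | H].
  - destruct (crit_sub U P H) as (H1 & _ & ->). nra.
  - destruct (crit_super U P H) as (H1 & _ & ->).
    rewrite snd_vel by assumption. unfold physical in P; nra.
Qed.

Lemma end_speed_decr U x y : physical U -> 0 < x -> x < y ->
  end_speed c U y < end_speed c U x.
Proof.
  intros P Hx Hy; unfold end_speed.
  assert (psi (fst U) x < psi (fst U) y) by (apply psi_incr; assumption). nra.
Qed.

Lemma end_speed_neg U x : physical U -> crit U < x -> end_speed c U x < 0.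
Proof.
  intros P Hx. rewrite <- (crit_speed U P).
  apply end_speed_decr; [assumption | apply crit_pos, P | assumption].
Qed.

Lemma crit_le U x : physical U -> 0 < x -> end_speed c U x <= 0 -> crit U <= x.
Proof.
  intros P Hx H. apply Rnot_lt_le; intros K.
  generalize (end_speed_decr U x (crit U) P Hx K). rewrite crit_speed by assumption; lra.
Qed.

Lemma crit_lt U x : physical U -> 0 < x -> end_speed c U x < 0 -> crit U < x.
Proof.
  intros P Hx H. destruct (crit_le U x P Hx) as [K | K]; [lra | exact K |].
  rewrite <- K, crit_speed in H by assumption; lra.
Qed.

(** On a fan the momentum has derivative [u - c], which is [end_speed]; behind a shock it
    is [shock_mom], whose factor [end_speed] is nonpositive and decreasing. *)
Lemma curve_mom_decr U x y : physical U -> crit U <= x -> x < y ->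
  curve_mom c U y < curve_mom c U x.
Proof.
  intros P Hx Hxy. assert (Hc := crit_pos U P).
  assert (E0 : forall z, crit U <= z -> end_speed c U z <= 0).
  { intros z [Hz | <-]; [left; apply end_speed_neg; assumption |].
    rewrite crit_speed by assumption; lra. }
  assert (G1 : forall x y, crit U <= x -> x < y -> y <= fst U ->
    curve_mom c U y < curve_mom c U x).
  { intros s t Hs Hst Ht. assert (E := E0 s Hs).
    rewrite end_speed_rarefaction in E by (try assumption; lra).
    unfold curve_mom.
    assert (Ev : curve_vel c U t = curve_vel c U s - c * (ln t - ln s)).
    { unfold curve_vel; rewrite !phi_le by lra; ring. }
    rewrite Ev.
    assert (Hln : 1 + (ln s - ln t) < s / t).
    { replace (s / t) with (exp (ln s - ln t)).
      apply exp_ineq1, Rlt_not_eq.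
      assert (ln s < ln t) by (apply ln_increasing; lra). lra.
      unfold Rminus; rewrite exp_plus, exp_Ropp, !exp_ln by lra. reflexivity. }
    assert (Hln' : t - s < t * (ln t - ln s)).
    { apply Rmult_lt_compat_l with (r := t) in Hln; [| lra].
      replace (t * (s / t)) with s in Hln by (field; lra). lra. }
    assert ((t - s) * (curve_vel c U s - c) <= 0) by nra.
    assert (c * (t - s) < c * (t * (ln t - ln s))) by (apply Rmult_lt_compat_l; lra).
    lra. }
  assert (G2 : forall x y, crit U <= x -> fst U <= x -> x < y ->
    curve_mom c U y < curve_mom c U x).
  { intros s t Hs Hs' Hst. rewrite !shock_mom by (assumption || lra).
    assert (E := E0 s Hs).
    assert (end_speed c U t < end_speed c U s) by (apply end_speed_decr; lra || assumption).
    nra. }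
  destruct (Rle_or_lt y (fst U)); [apply G1; lra |].
  destruct (Rle_or_lt (fst U) x); [apply G2; lra |].
  generalize (G1 x (fst U)) (G2 (fst U) y); lra.
Qed.

Lemma curve_mom_continuous U x : physical U -> 0 < x -> continuity_pt (curve_mom c U) x.
Proof.
  intros P Hx. unfold curve_mom, curve_vel.
  apply (continuity_pt_mult (fun x => x)). apply continuity_pt_id.
  apply (continuity_pt_minus (fun _ => vel U)).
  apply continuity_pt_const; now intros ? ?.
  apply (continuity_pt_scal (phi (fst U))), phi_continuous; assumption.
Qed.

Lemma psi_square a M : 0 < a -> 1 <= M -> psi a (a * M ^ 2) = M.
Proof.
  intros Ha HM. assert (1 <= M ^ 2) by nra. rewrite psi_ge by nra.
  replace (a * (a * M ^ 2)) with ((a * M) * (a * M)) by ring.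
  rewrite sqrt_mult_self by nra. field; lra.
Qed.

Lemma curve_mom_unbounded U y : physical U ->
  exists x, crit U <= x /\ curve_mom c U x <= y.
Proof.
  intros P. assert (P' := P); unfold physical in P.
  set (M := Rmax 1 ((vel U + 1) / c)).
  assert (1 <= M) by apply Rmax_l.
  assert (HM : vel U + 1 <= c * M).
  { assert ((vel U + 1) / c <= M) by apply Rmax_r.
    apply Rmult_le_compat_l with (r := c) in H0; [| lra].
    replace (c * ((vel U + 1) / c)) with (vel U + 1) in H0 by (field; lra). lra. }
  set (x1 := fst U * M ^ 2). assert (fst U <= x1).
  { assert (1 <= M ^ 2) by nra. unfold x1; nra. }
  assert (E1 : end_speed c U x1 <= -1).
  { unfold end_speed, x1; rewrite psi_square by assumption; lra. }
  set (x := Rmax x1 (fst U + Rabs (snd U - y))).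
  assert (x1 <= x) by apply Rmax_l.
  assert (fst U + Rabs (snd U - y) <= x) by apply Rmax_r.
  assert (snd U - y <= Rabs (snd U - y)) by apply Rle_abs.
  assert (0 <= Rabs (snd U - y)) by apply Rabs_pos.
  assert (E : end_speed c U x <= -1).
  { destruct H1 as [K | <-]; [| exact E1].
    generalize (end_speed_decr U x1 x P'); lra. }
  exists x; split.
  - apply crit_le; [assumption | lra | lra].
  - rewrite shock_mom by (assumption || lra). nra.
Qed.

(** Beyond [crit U] all 1-waves have ended by speed 0, so these are the densities of left
    traces on the 1-wave curve, indexed here by the flux.  Fluxes above the largest one,
    [crit_mom U], are all sent to [crit U]. *)
Definition ell (U : state) : R -> R := decr_inverse (curve_mom c U) (crit U).

Section Ell.
Variable U : state.
Hypothesis P : physical U.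

Lemma ell_hyp_cont x : crit U <= x -> continuity_pt (curve_mom c U) x.
Proof. intros H; apply curve_mom_continuous; [| generalize (crit_pos U P)]; lra || assumption. Qed.

Lemma ell_hyp_decr x y : crit U <= x -> x < y -> curve_mom c U y < curve_mom c U x.
Proof. apply curve_mom_decr, P. Qed.

Lemma ell_hyp_unb y : exists x, crit U <= x /\ curve_mom c U x <= y.
Proof. apply curve_mom_unbounded, P. Qed.

Lemma ell_crit alpha : crit U <= ell U alpha.
Proof.
  apply (decr_inverse_spec _ _ ell_hyp_cont ell_hyp_unb).
Qed.

Lemma ell_pos alpha : 0 < ell U alpha.
Proof. generalize (crit_pos U P) (ell_crit alpha); lra. Qed.

Lemma ell_mom alpha : alpha <= crit_mom U -> curve_mom c U (ell U alpha) = alpha.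
Proof. apply (decr_inverse_right _ _ ell_hyp_cont ell_hyp_unb). Qed.

Lemma ell_curve_mom x : crit U <= x -> ell U (curve_mom c U x) = x.
Proof.
  apply (decr_inverse_left _ _ ell_hyp_cont ell_hyp_decr ell_hyp_unb).
Qed.

Lemma ell_le alpha x : crit U <= x -> curve_mom c U x <= alpha -> ell U alpha <= x.
Proof. apply (decr_inverse_le _ _ ell_hyp_cont ell_hyp_decr ell_hyp_unb). Qed.

Lemma ell_gt alpha x : crit U <= x -> alpha < curve_mom c U x -> x < ell U alpha.
Proof. apply (decr_inverse_gt _ _ ell_hyp_cont ell_hyp_decr ell_hyp_unb). Qed.

Lemma ell_gt_crit alpha : alpha < crit_mom U -> crit U < ell U alpha.
Proof. intros; apply ell_gt; [lra | assumption]. Qed.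

Lemma ell_decr alpha beta : alpha <= beta -> ell U beta <= ell U alpha.
Proof. apply (decr_inverse_decr _ _ ell_hyp_cont ell_hyp_decr ell_hyp_unb). Qed.

Lemma ell_decr_strict alpha beta : alpha < beta -> alpha < crit_mom U ->
  ell U beta < ell U alpha.
Proof.
  intros H H0. destruct (ell_decr alpha beta) as [K | K]; [lra | exact K |].
  exfalso. destruct (Rle_or_lt beta (crit_mom U)) as [L | L].
  - generalize (ell_mom alpha) (ell_mom beta). rewrite K. lra.
  - assert (ell U beta <= crit U). { apply ell_le; [lra |]. unfold crit_mom in L; lra. }
    generalize (ell_gt_crit alpha H0); lra.
Qed.

Lemma ell_continuous alpha : continuity_pt (ell U) alpha.
Proof. apply (decr_inverse_continuous _ _ ell_hyp_cont ell_hyp_decr ell_hyp_unb). Qed.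

Lemma ell_crit_mom : ell U (crit_mom U) = crit U.
Proof. apply ell_curve_mom; lra. Qed.

Lemma curve_state alpha : alpha <= crit_mom U ->
  vel (ell U alpha, alpha) = curve_vel c U (ell U alpha).
Proof.
  intros H. generalize (ell_mom alpha H) (ell_pos alpha).
  unfold vel, curve_mom; simpl; intros E L.
  rewrite <- E at 1. field. lra.
Qed.

(** A 1-wave that ends at a nonpositive speed leaves a state with [u - c <= 0]. *)
Lemma ell_subsonic alpha : alpha <= crit_mom U -> alpha / c <= ell U alpha.
Proof.
  intros H. assert (V := curve_state alpha H). assert (L := ell_pos alpha).
  assert (E : end_speed c U (ell U alpha) <= 0).
  { destruct (ell_crit alpha) as [K | K].
    left; apply end_speed_neg; assumption. rewrite <- K, crit_speed by assumption; lra. }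
  assert (psi (fst U) (ell U alpha) <= 1 + phi (fst U) (ell U alpha))
    by (apply psi_le_phi; assumption).
  assert (K : vel (ell U alpha, alpha) <= c).
  { rewrite V; unfold curve_vel, end_speed in *; nra. }
  unfold vel in K; simpl in K.
  apply Rmult_le_reg_r with (c / ell U alpha).
  apply Rdiv_lt_0_compat; lra. field_simplify; lra.
Qed.
End Ell.

(** [phi a] tends to minus infinity at 0, logarithmically, and to plus infinity like a
    square root; the two bounds below make this explicit. *)
Lemma middle_exists Ua Ub : physical Ua -> physical Ub -> exists x, middle c Ua Ub x.
Proof.
  intros Pa Pb. unfold middle, curve_vel.
  set (a := fst Ua). change (fst (mirror Ub)) with (fst Ub). set (b := fst Ub).
  unfold physical in *. fold a in Pa. fold b in Pb.
  set (C := (vel Ua + vel (mirror Ub)) / c).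
  set (N := 1 + Rabs C). assert (- N <= C <= N).
  { unfold N; generalize (Rle_abs C) (Rle_abs (- C)); rewrite Rabs_Ropp; lra. }
  assert (1 <= N) by (unfold N; generalize (Rabs_pos C); lra).
  set (lo := Rmin a b * exp (- N)).
  set (hi := Rmax a b * (N + 1) ^ 2).
  assert (0 < Rmin a b) by (apply Rmin_pos; lra).
  assert (Rmin a b <= a) by apply Rmin_l. assert (Rmin a b <= b) by apply Rmin_r.
  assert (a <= Rmax a b) by apply Rmax_l. assert (b <= Rmax a b) by apply Rmax_r.
  assert (0 < exp (- N)) by apply exp_pos.
  assert (exp (- N) < 1) by (rewrite <- exp_0; apply exp_increasing; lra).
  assert (0 < lo) by (unfold lo; nra).
  assert (lo <= Rmin a b) by (unfold lo; nra).
  assert (1 <= (N + 1) ^ 2) by nra.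
  assert (Rmax a b <= hi) by (unfold hi; nra).
  assert (Hlo : forall d, 0 < d -> Rmin a b <= d -> phi d lo <= - N).
  { intros d Hd Hd'. apply Rle_trans with (phi d (d * exp (- N))).
    apply phi_incr_le; [lra | lra | unfold lo; nra].
    rewrite phi_le, ln_mult, ln_exp; nra. }
  assert (Hhi : forall d, 0 < d -> d <= Rmax a b -> N <= phi d hi).
  { intros d Hd Hd'. apply Rle_trans with (phi d (d * (N + 1) ^ 2)).
    2: apply phi_incr_le; [lra | nra | unfold hi; nra].
    rewrite phi_shock, psi_square by nra.
    replace (d * (d * (N + 1) ^ 2)) with ((d * (N + 1)) * (d * (N + 1))) by ring.
    rewrite sqrt_mult_self by nra.
    assert (d / (d * (N + 1)) <= 1); [| lra].
    apply Rmult_le_reg_r with (N + 1); [lra |]. field_simplify; lra. }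
  destruct (ivt (fun x => phi a x + phi b x) lo hi C) as (x & Hx & Ex).
  - lra.
  - intros x Hx; apply continuity_pt_plus; apply phi_continuous; lra.
  - left. generalize (Hlo a Pa) (Hlo b Pb) (Hhi a Pa) (Hhi b Pb); lra.
  - exists x; split; [lra |].
    assert (c * C = vel Ua + vel (mirror Ub)) by (unfold C; field; lra). nra.
Qed.

(** Applied to the mirror image of a trace, this says that a 2-wave on the left of the
    particle can only end at a supersonic state that flows to the left. *)
Lemma start_speed_nonneg U x : physical U -> 0 < x -> 0 <= start_speed c U x ->
  c <= vel U.
Proof.
  intros P Hx. destruct (Rle_or_lt x (fst U)) as [K | K].
  - rewrite start_speed_rarefaction; lra.
  - rewrite start_speed_shock by assumption. unfold end_speed.
    assert (psi (fst U) (fst U) < psi (fst U) x) by (apply psi_incr; assumption).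
    rewrite psi_self in H by assumption. nra.
Qed.

Lemma vel_pos_snd U : physical U -> 0 < vel U -> 0 < snd U.
Proof. intros P H; rewrite snd_vel by assumption; unfold physical in P; nra. Qed.

Lemma trace_curve_inv UL U : physical UL -> physical U ->
  vel U = curve_vel c UL (fst U) -> end_speed c UL (fst U) <= 0 ->
  snd U <= crit_mom UL /\ fst U = ell UL (snd U).
Proof.
  intros PL P V E.
  assert (K : crit UL <= fst U) by (apply crit_le; assumption).
  assert (Q : snd U = curve_mom c UL (fst U)).
  { unfold curve_mom; rewrite <- V; apply snd_vel, P. }
  rewrite Q. split; [| rewrite ell_curve_mom; easy].
  destruct K as [K | <-]; [left; apply curve_mom_decr; lra || assumption | ].
  unfold crit_mom; lra.
Qed.

(** When [UL] is supersonic the end [crit UL] of the curve is behind a stationary shock,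
    which is not a trace; [UL] itself takes its place at the same flux. *)
Lemma trace_nonneg_inv UL U : physical UL -> physical U -> trace c UL U ->
  0 <= snd U ->
  snd U <= crit_mom UL /\
  ((fst U = ell UL (snd U) /\ (c < vel UL -> snd U < crit_mom UL)) \/
   (U = UL /\ c < vel UL)).
Proof.
  intros PL P T Hs.
  assert (K1 : forall V, physical V -> vel V = curve_vel c UL (fst V) ->
    end_speed c UL (fst V) <= 0 ->
    (fst UL < fst V -> end_speed c UL (fst V) < 0) ->
    snd V <= crit_mom UL /\
    ((fst V = ell UL (snd V) /\ (c < vel UL -> snd V < crit_mom UL)) \/
     (V = UL /\ c < vel UL))).
  { intros V PV EV E1 E2. destruct (trace_curve_inv UL V PL PV EV E1) as [H1 H2].
    split; [exact H1 |]. left; split; [exact H2 |]. intros Hc.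
    destruct (crit_super UL PL Hc) as (L & _ & _).
    assert (crit UL <= fst V) by (apply crit_le; assumption).
    assert (crit UL < fst V) by (apply crit_lt; try assumption; apply E2; lra).
    replace (snd V) with (curve_mom c UL (fst V)).
    apply curve_mom_decr; lra || assumption.
    unfold curve_mom; rewrite <- EV; symmetry; apply snd_vel, PV. }
  destruct (trace_inv c c_pos UL U PL P T) as [[-> H] | [(H1 & H2 & H3) | H]].
  - destruct (Rle_or_lt (vel UL) c) as [K | K].
    + apply K1; try assumption; rewrite ?curve_vel_self, ?end_speed_self by assumption; lra.
    + split; [| right; split; [reflexivity | exact K]].
      unfold crit_mom. destruct (crit_super UL PL K) as (_ & _ & ->); lra.
  - apply K1; assumption.
  - destruct H as (x & [Hx _] & _ & H & _).
    apply start_speed_nonneg in H; [| exact P | exact Hx].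
    rewrite vel_mirror in H. exfalso.
    assert (0 < vel (mirror U)) by (rewrite vel_mirror; lra).
    apply vel_pos_snd in H0; [simpl in H0; lra | exact P].
Qed.

(** For [alpha < 0] a subsonic state on the curve can be left behind by a 2-wave of negative speed,
    whose end is more supersonic than the state behind a stationary shock, or, if the state
    on the curve is already supersonic, by any 2-wave ending at a supersonic state.  The
    maximum with the sonic density covers both cases: the left traces are the density
    [threshold UL alpha] and those below its conjugate
    [alpha^2 / (c^2 * threshold UL alpha)]. *)
Definition threshold (UL : state) (alpha : R) : R := Rmax (ell UL alpha) (Rabs alpha / c).

Lemma threshold_pos UL alpha : physical UL -> 0 < threshold UL alpha.
Proof.
  intros P; unfold threshold. generalize (ell_pos UL P alpha)
    (Rmax_l (ell UL alpha) (Rabs alpha / c)); lra.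
Qed.

(** A 2-fan that ends by speed 0 starts at a middle state with [u <= - c], and the velocity
    decreases along the 1-wave curve, so the curve is supersonic at this flux.  A 2-shock
    of negative speed [s] from the density [x] gives [alpha - s * rho = - c * sqrt (rho * x)],
    hence [alpha^2 > c^2 * rho * x], while its left momentum is below [alpha], which places
    [x] beyond [ell UL alpha]. *)
Lemma trace_neg_inv UL U : physical UL -> physical U -> trace c UL U ->
  snd U < 0 ->
  fst U = threshold UL (snd U) \/ c ^ 2 * fst U * threshold UL (snd U) < snd U ^ 2.
Proof.
  intros PL P T Hs. unfold threshold. rewrite Rabs_left by exact Hs.
  assert (Hq := crit_mom_pos UL PL).
  set (al := snd U) in *.
  assert (Pf : 0 < fst U) by exact P.
  assert (R0 : c ^ 2 * fst U * (- al / c) = c * fst U * - al) by (field; lra).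
  assert (Hca : c * (- al / c) = - al) by (field; lra).
  assert (Hsup : forall z, c * fst U < - al -> c ^ 2 * fst U * z < al ^ 2 ->
    c ^ 2 * fst U * Rmax z (- al / c) < al ^ 2).
  { intros z H1 H2. unfold Rmax; destruct (Rle_dec z (- al / c)); [| exact H2].
    rewrite R0; nra. }
  destruct (trace_inv c c_pos UL U PL P T) as [[E H] | [(H1 & H2 & H3) | H]].
  - exfalso. assert (0 < vel U) by (rewrite E; lra).
    apply vel_pos_snd in H0; [fold al in H0; lra | exact P].
  - destruct (trace_curve_inv UL U PL P H1 H2) as [K1 K2]. fold al in K1, K2.
    rewrite <- K2.
    destruct (Rle_or_lt (- al / c) (fst U)) as [K | K].
    + left; rewrite Rmax_left; lra.
    + right. rewrite Rmax_right by lra. rewrite R0.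
      assert (c * fst U < - al) by nra. nra.
  - destruct H as (x & [Hx Mx] & He & Hst & Hm & Hsh).
    assert (Lx : crit UL < x) by (apply crit_lt; assumption).
    assert (Vm : fst U * vel (mirror U) = - al).
    { rewrite vel_mirror. unfold al; rewrite (snd_vel U P); ring. }
    assert (Eal := ell_mom UL PL al). 
    destruct (Rle_or_lt x (fst U)) as [K | K].
    + rewrite start_speed_rarefaction in Hst by exact K.
      assert (L : c * fst U <= - al) by nra.
      assert (Hell : ell UL al <= - al / c).
      { apply Rnot_lt_le; intros G.
        assert (x < ell UL al).
        { apply Rle_lt_trans with (fst U); [exact K |].
          apply Rnot_le_lt; intros G'. nra. }
        assert (V1 : curve_vel c UL (ell UL al) < curve_vel c UL x)
          by (apply curve_vel_decr; assumption).
        assert (V2 : curve_vel c UL x <= - c).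
        { assert (E := end_speed_rarefaction c (mirror U) x P K). lra. }
        assert (E := Eal). unfold curve_mom in E.
        assert (G' : - al < c * ell UL al).
        { rewrite <- Hca. apply Rmult_lt_compat_l; assumption. }
        generalize (ell_pos UL PL al). intros. nra. }
      rewrite Rmax_right by exact Hell. destruct L as [L | L].
      * right. rewrite R0. nra.
      * left. rewrite <- L. field; lra.
    + right. rewrite start_speed_shock in Hst, Hsh by exact K.
      specialize (Hsh K).
      assert (Q := shock_mom (mirror U) x P (Rlt_le _ _ K)).
      simpl in Q. fold al in Q.
      assert (QL : curve_mom c UL x < al).
      { unfold curve_mom in *. assert (0 < x - fst U) by lra. nra. }
      assert (ell UL al <= x) by (apply ell_le; lra || assumption).
      unfold end_speed in Hsh. rewrite psi_ge in Hsh by (simpl; lra).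
      simpl in Hsh.
      destruct (sqrt_mult_pos (fst U) x) as [Hk Hkk]; try lra.
      set (k := sqrt (fst U * x)) in *.
      assert (ck : c * k < - al).
      { apply Rmult_lt_compat_l with (r := fst U) in Hsh; [| exact Pf].
        replace (fst U * (vel (mirror U) - c * (k / fst U)))
          with (fst U * vel (mirror U) - c * k) in Hsh by (field; lra). lra. }
      assert (fst U < k) by nra.
      assert (c ^ 2 * (fst U * x) < al ^ 2).
      { rewrite <- Hkk. replace (c ^ 2 * (k * k)) with ((c * k) * (c * k)) by ring.
        assert (0 < c * k) by nra. nra. }
      assert (0 < c ^ 2 * fst U) by (apply Rmult_lt_0_compat; [apply pow_lt |]; assumption).
      assert (c ^ 2 * fst U * ell UL al <= c ^ 2 * fst U * x)
        by (apply Rmult_le_compat_l; lra).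
      apply Hsup; [nra | lra].
Qed.

Lemma trace_nonneg_intro UL alpha : physical UL -> 0 <= alpha < crit_mom UL ->
  trace c UL (ell UL alpha, alpha).
Proof.
  intros PL H. apply trace_curve; try assumption.
  - apply ell_pos, PL.
  - apply curve_state; lra || assumption.
  - simpl. apply end_speed_neg; [assumption |]. apply ell_gt_crit; lra || assumption.
  - unfold vel; simpl. assert (0 <= alpha / ell UL alpha); [| lra].
    apply Rmult_le_pos; [lra |]. left; apply Rinv_0_lt_compat, ell_pos, PL.
Qed.

(** The converse computation: were the 2-shock of the Riemann solution not of negative
    speed, the middle density [x] would be at most [ell UL alpha] and satisfy
    [alpha^2 <= c^2 * rho * x]. *)
Lemma trace_neg_intro UL rho alpha : physical UL -> 0 < rho -> alpha < 0 ->
  rho = threshold UL alpha \/ c ^ 2 * rho * threshold UL alpha < alpha ^ 2 ->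
  trace c UL (rho, alpha).
Proof.
  intros PL Hr Ha H. unfold threshold in H. rewrite Rabs_left in H by exact Ha.
  assert (Hq := crit_mom_pos UL PL).
  assert (Hl := ell_pos UL PL alpha).
  assert (P : physical (rho, alpha)) by exact Hr.
  assert (Em := ell_mom UL PL alpha).
  assert (Hca : c * (- alpha / c) = - alpha) by (field; lra).
  set (s := - alpha / c) in *.
  assert (R0 : c ^ 2 * rho * s = c * rho * - alpha) by (rewrite <- Hca; ring).
  assert (Hcr : 0 < c ^ 2 * rho)
    by (apply Rmult_lt_0_compat; [apply pow_lt |]; assumption).
  assert (Alt : (rho = ell UL alpha /\ s <= rho) \/ (c * rho <= - alpha /\
    (c ^ 2 * rho * ell UL alpha < alpha ^ 2 \/ ell UL alpha <= rho))).
  { destruct (Rle_or_lt s (ell UL alpha)) as [K | K].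
    - rewrite Rmax_left in H by exact K.
      destruct H as [H | H]; [left; lra | right].
      assert (c ^ 2 * rho * s <= c ^ 2 * rho * ell UL alpha)
        by (apply Rmult_le_compat_l; lra).
      split; [nra | left; exact H].
    - rewrite Rmax_right in H by lra.
      destruct H as [H | H]; [right; rewrite H, Hca; lra | right].
      assert (c ^ 2 * rho * ell UL alpha <= c ^ 2 * rho * s)
        by (apply Rmult_le_compat_l; lra).
      split; [nra | left; lra]. }
  destruct Alt as [[-> K] | [Hsup Alt]].
  { apply trace_curve; try assumption.
    - apply curve_state; lra || assumption.
    - simpl. apply end_speed_neg; [assumption |]. apply ell_gt_crit; lra || assumption.
    - unfold vel; simpl. apply Rmult_le_reg_r with (ell UL alpha); [exact Hl |].
      field_simplify; nra. }
  destruct (middle_exists UL (rho, alpha) PL P) as (x & M).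
  assert (Vm : rho * vel (mirror (rho, alpha)) = - alpha)
    by (unfold vel; simpl; field; lra).
  assert (Hshock : rho < x -> 0 < start_speed c (mirror (rho, alpha)) x).
  { intros Hx. rewrite start_speed_shock by (simpl; lra).
    apply Rnot_le_lt; intros Hs.
    assert (Q := shock_mom (mirror (rho, alpha)) x P (Rlt_le _ _ Hx)).
    simpl in Q. destruct M as [M1 M2].
    assert (QL : alpha <= curve_mom c UL x).
    { unfold curve_mom in *. assert (0 < x - rho) by lra. nra. }
    assert (x <= ell UL alpha).
    { apply Rnot_lt_le; intros G.
      generalize (curve_mom_decr UL (ell UL alpha) x PL (ell_crit UL PL alpha) G).
      rewrite Em; lra. }
    destruct Alt as [Alt | Alt]; [| lra].
    unfold end_speed in Hs. rewrite psi_ge in Hs by (simpl; lra).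
    simpl in Hs.
    destruct (sqrt_mult_pos rho x) as [Hk Hkk]; try lra.
    set (k := sqrt (rho * x)) in *.
    assert (ck : - alpha <= c * k).
    { apply Rmult_le_compat_l with (r := rho) in Hs; [| lra].
      replace (rho * (vel (mirror (rho, alpha)) - c * (k / rho)))
        with (rho * vel (mirror (rho, alpha)) - c * k) in Hs by (field; lra). lra. }
    assert (alpha ^ 2 <= c ^ 2 * (rho * x)).
    { rewrite <- Hkk.
      replace (c ^ 2 * (k * k)) with ((c * k) * (c * k)) by ring. nra. }
    nra. }
  apply trace_two with x; try assumption.
  destruct (Rle_or_lt x rho) as [K | K]; [| left; apply Hshock, K].
  rewrite start_speed_rarefaction by exact K. nra.
Qed.
End Curve.

(** * The loss through the particle *)

Section Drag.
Variable c : R.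
Hypothesis c_pos : 0 < c.
Variable D : R -> R -> R.
Hypothesis HD : admissible D.

Definition integrand (alpha r : R) : R :=
  / Rabs (D r alpha) * (c ^ 2 - alpha ^ 2 / r ^ 2).

Lemma integrand_continuous_2d alpha r : 0 < alpha -> 0 < r ->
  continuity_2d_pt integrand alpha r.
Proof.
  intros Ha Hr. unfold integrand.
  assert (HDp := adm_pos D HD r alpha Hr Ha).
  apply continuity_2d_pt_mult.
  - apply continuity_2d_pt_inv.
    2: apply Rabs_no_R0, Rgt_not_eq, HDp.
    apply (continuity_1d_2d_pt_comp Rabs (fun a r => D r a)).
    apply Rcontinuity_abs.
    generalize (adm_cont D HD r alpha Hr). intros K eps.
    destruct (K eps) as [d Hd]. exists d; intros u v Hu Hv; apply Hd; assumption.
  - apply continuity_2d_pt_minus. apply continuity_2d_pt_const.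
    apply (continuity_2d_pt_mult (fun a _ => a ^ 2) (fun _ r => / r ^ 2)).
    + apply (continuity_1d_2d_pt_comp (fun a => a ^ 2) (fun a _ => a)).
      apply continuity_pt_derivable; auto_derive; easy.
      apply continuity_2d_pt_id1.
    + apply (continuity_1d_2d_pt_comp (fun r => / r ^ 2) (fun _ r => r)).
      apply continuity_pt_derivable; auto_derive; nra.
      apply continuity_2d_pt_id2.
Qed.

Lemma continuity_2d_slice f x y : continuity_2d_pt f x y -> continuous (f x) y.
Proof.
  intros K. apply filterlim_locally. intros eps.
  destruct (K eps) as [d Hd]. exists d. intros z Hz. apply Hd; [| exact Hz].
  rewrite Rminus_eq_0, Rabs_R0; apply cond_pos.
Qed.

Lemma Rmin_pos_between x y z : 0 < x -> 0 < y -> Rmin x y <= z -> 0 < z.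
Proof. intros Hx Hy; generalize (Rmin_pos x y Hx Hy); lra. Qed.

Lemma integrand_ex_RInt alpha x y : 0 < alpha -> 0 < x -> 0 < y ->
  ex_RInt (integrand alpha) x y.
Proof.
  intros Ha Hx Hy. apply (ex_RInt_continuous (integrand alpha)). intros z Hz.
  apply continuity_2d_slice, integrand_continuous_2d; [exact Ha |].
  apply (Rmin_pos_between x y); tauto.
Qed.

Lemma F_diff alpha x y : 0 < alpha -> 0 < x -> 0 < y ->
  F c D alpha y - F c D alpha x = RInt (integrand alpha) x y.
Proof.
  intros Ha Hx Hy. unfold F. rewrite Rabs_right by lra.
  assert (0 < alpha / c) by (apply Rdiv_lt_0_compat; assumption).
  assert (K := RInt_Chasles (V := R_CompleteNormedModule) (integrand alpha)
    (alpha / c) x y (integrand_ex_RInt _ _ _ Ha H Hx) (integrand_ex_RInt _ _ _ Ha Hx Hy)).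
  unfold plus in K; simpl in K. unfold integrand in K at 1 3. unfold integrand in *.
  lra.
Qed.

Lemma F_sonic alpha : 0 < alpha -> F c D alpha (alpha / c) = 0.
Proof.
  intros Ha; unfold F; rewrite Rabs_right by lra.
  apply (RInt_point (V := R_CompleteNormedModule)).
Qed.

Lemma F_derive alpha x : 0 < alpha -> 0 < x ->
  is_derive (F c D alpha) x (integrand alpha x).
Proof.
  intros Ha Hx. unfold F. rewrite Rabs_right by lra.
  assert (0 < alpha / c) by (apply Rdiv_lt_0_compat; assumption).
  apply (is_derive_RInt (integrand alpha) (fun y => RInt (integrand alpha) (alpha / c) y)
    (alpha / c) x).
  - assert (K : locally x (fun y => 0 < y)) by (apply open_gt; exact Hx).
    revert K; apply filter_imp; intros y Hy.
    apply (RInt_correct (integrand alpha)), integrand_ex_RInt; assumption.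
  - apply continuity_2d_slice, integrand_continuous_2d; assumption.
Qed.

Lemma F_continuous alpha x : 0 < alpha -> 0 < x -> continuity_pt (F c D alpha) x.
Proof.
  intros Ha Hx; apply continuity_pt_derivable. eexists; apply F_derive; assumption.
Qed.

Lemma sonic_super alpha r : 0 < alpha -> 0 < r -> r < alpha / c ->
  c ^ 2 - alpha ^ 2 / r ^ 2 < 0.
Proof.
  intros Ha Hr H.
  assert (c * r < alpha).
  { apply Rmult_lt_compat_l with (r := c) in H; [| lra].
    replace (c * (alpha / c)) with alpha in H by (field; lra). exact H. }
  apply Rmult_lt_reg_r with (r ^ 2); [nra |].
  replace ((c ^ 2 - alpha ^ 2 / r ^ 2) * r ^ 2) with ((c * r) * (c * r) - alpha * alpha)
    by (field; lra).
  assert (0 < c * r) by nra. nra.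
Qed.

Lemma sonic_sub alpha r : 0 < alpha -> 0 < r -> alpha / c < r ->
  0 < c ^ 2 - alpha ^ 2 / r ^ 2.
Proof.
  intros Ha Hr H.
  assert (alpha < c * r).
  { apply Rmult_lt_compat_l with (r := c) in H; [| lra].
    replace (c * (alpha / c)) with alpha in H by (field; lra). exact H. }
  apply Rmult_lt_reg_r with (r ^ 2); [nra |].
  replace ((c ^ 2 - alpha ^ 2 / r ^ 2) * r ^ 2) with ((c * r) * (c * r) - alpha * alpha)
    by (field; lra).
  nra.
Qed.

Lemma abs_drag_pos alpha r : 0 < alpha -> 0 < r -> 0 < / Rabs (D r alpha).
Proof.
  intros Ha Hr; apply Rinv_0_lt_compat, Rabs_pos_lt, Rgt_not_eq, (adm_pos D HD); assumption.
Qed.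

Lemma F_incr alpha x y : 0 < alpha -> alpha / c <= x -> x < y ->
  F c D alpha x < F c D alpha y.
Proof.
  intros Ha Hx Hxy. assert (0 < alpha / c) by (apply Rdiv_lt_0_compat; assumption).
  apply Rlt_0_minus. rewrite F_diff by lra.
  apply RInt_gt_0; [exact Hxy | |].
  - intros z Hz; apply Rmult_lt_0_compat; [apply abs_drag_pos | apply sonic_sub]; lra.
  - intros z Hz; apply continuity_2d_slice, integrand_continuous_2d; lra.
Qed.

Lemma F_decr alpha x y : 0 < alpha -> 0 < x -> x < y -> y <= alpha / c ->
  F c D alpha y < F c D alpha x.
Proof.
  intros Ha Hx Hxy Hy.
  assert (0 < - (F c D alpha y - F c D alpha x)); [| lra].
  rewrite F_diff by lra.
  assert (E := RInt_opp (V := R_CompleteNormedModule) (integrand alpha) x y).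
  unfold opp in E; simpl in E. rewrite <- E.
  2: apply integrand_ex_RInt; lra.
  apply RInt_gt_0; [exact Hxy | |].
  - intros z Hz. unfold integrand.
    assert (0 < / Rabs (D z alpha)) by (apply abs_drag_pos; lra).
    assert (c ^ 2 - alpha ^ 2 / z ^ 2 < 0) by (apply sonic_super; lra). nra.
  - intros z Hz. apply (continuous_opp (integrand alpha)).
    apply continuity_2d_slice, integrand_continuous_2d; lra.
Qed.

Lemma F_incr_le alpha x y : 0 < alpha -> alpha / c <= x -> x <= y ->
  F c D alpha x <= F c D alpha y.
Proof. intros Ha Hx [H | ->]; [left; apply F_incr; assumption | lra]. Qed.

Lemma F_decr_le alpha x y : 0 < alpha -> 0 < x -> x <= y -> y <= alpha / c ->
  F c D alpha y <= F c D alpha x.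
Proof. intros Ha Hx [H | ->] Hy; [left; apply F_decr; assumption | lra]. Qed.

Lemma F_sub_nonneg alpha x : 0 < alpha -> alpha / c <= x -> 0 <= F c D alpha x.
Proof. intros Ha Hx; rewrite <- (F_sonic alpha Ha); apply F_incr_le; lra. Qed.

Lemma F_sup_nonneg alpha x : 0 < alpha -> 0 < x -> x <= alpha / c ->
  0 <= F c D alpha x.
Proof. intros Ha Hx Hs; rewrite <- (F_sonic alpha Ha); apply F_decr_le; lra. Qed.

Lemma F_sub_reflect alpha x y : 0 < alpha -> alpha / c <= x -> alpha / c <= y ->
  F c D alpha x <= F c D alpha y -> x <= y.
Proof.
  intros Ha Hx Hy H; apply Rnot_lt_le; intros K.
  generalize (F_incr alpha y x Ha Hy K); lra.
Qed.

Lemma F_sup_reflect alpha x y : 0 < alpha -> 0 < x <= alpha / c -> 0 < y <= alpha / c ->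
  F c D alpha x <= F c D alpha y -> y <= x.
Proof.
  intros Ha Hx Hy H; apply Rnot_lt_le; intros K.
  generalize (F_decr alpha x y Ha); lra.
Qed.

(** Density on the other side of a stationary shock. *)
Definition conjugate (alpha x : R) : R := alpha ^ 2 / (c ^ 2 * x).

Lemma conjugate_pos alpha x : 0 < alpha -> 0 < x -> 0 < conjugate alpha x.
Proof.
  intros; apply Rdiv_lt_0_compat. apply pow_lt; assumption.
  apply Rmult_lt_0_compat; [apply pow_lt |]; assumption.
Qed.

Lemma conjugate_eq alpha x : 0 < x -> c ^ 2 * x * conjugate alpha x = alpha ^ 2.
Proof. intros; unfold conjugate; field; lra. Qed.

Lemma conjugate_sonic alpha x : 0 < alpha -> 0 < x -> x <= alpha / c ->
  alpha / c <= conjugate alpha x.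
Proof.
  intros Ha Hx H. unfold conjugate.
  apply Rmult_le_reg_r with (c ^ 2 * x).
  apply Rmult_lt_0_compat; [apply pow_lt |]; assumption.
  replace (alpha ^ 2 / (c ^ 2 * x) * (c ^ 2 * x)) with (alpha * alpha) by (field; lra).
  replace (alpha / c * (c ^ 2 * x)) with (alpha * (c * x)) by (field; lra).
  apply Rmult_le_compat_l; [lra |].
  apply Rmult_le_compat_l with (r := c) in H; [| lra].
  replace (c * (alpha / c)) with alpha in H by (field; lra). exact H.
Qed.

Lemma conjugate_at_sonic alpha : 0 < alpha -> conjugate alpha (alpha / c) = alpha / c.
Proof. intros; unfold conjugate; field; lra. Qed.

Lemma conjugate_continuous alpha x : 0 < x -> continuity_pt (conjugate alpha) x.
Proof.
  intros Hx; apply continuity_pt_derivable; unfold conjugate; auto_derive.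
  apply Rgt_not_eq, Rmult_lt_0_compat; nra.
Qed.

(** The derivative of [F alpha (conjugate alpha z) - F alpha z] is
    [(alpha^2 / z^2 - c^2) * (1 / |D z| - 1 / |D (conjugate z)|)], since
    [alpha^2 / r + c^2 * r] takes the same value on both sides of a stationary shock; and
    behind the shock the gas is denser and feels less drag. *)
Lemma shock_gain_decr alpha x y : 0 < alpha -> 0 < x -> x <= y -> y <= alpha / c ->
  F c D alpha (conjugate alpha y) - F c D alpha y <=
  F c D alpha (conjugate alpha x) - F c D alpha x.
Proof.
  intros Ha Hx Hxy Hy.
  set (K := fun z => F c D alpha (conjugate alpha z) - F c D alpha z).
  set (dK := fun z => integrand alpha (conjugate alpha z) * (- alpha ^ 2 / (c ^ 2 * z ^ 2))
    - integrand alpha z).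
  assert (HK : forall z, 0 < z -> is_derive K z (dK z)).
  { intros z Hz. unfold K, dK.
    apply (is_derive_minus (fun z => F c D alpha (conjugate alpha z)) (F c D alpha)).
    2: apply F_derive; assumption.
    rewrite Rmult_comm.
    apply (is_derive_comp (F c D alpha) (conjugate alpha)).
    apply F_derive; [| apply conjugate_pos]; assumption.
    unfold conjugate; auto_derive; [| field; lra].
    apply Rgt_not_eq, Rmult_lt_0_compat; nra. }
  destruct (MVT_gen K x y dK) as (z & Hz & E).
  - rewrite Rmin_left, Rmax_right by lra. intros z Hz; apply HK; lra.
  - rewrite Rmin_left, Rmax_right by lra. intros z Hz.
    apply continuity_pt_derivable. eexists; apply HK; lra.
  - rewrite Rmin_left, Rmax_right in Hz by lra.
    assert (dK z <= 0); [| fold (K x); fold (K y); nra].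
    assert (Hs := conjugate_sonic alpha z Ha (Rlt_le_trans _ _ _ Hx (proj1 Hz))
      (Rle_trans _ _ _ (proj2 Hz) Hy)).
    assert (Hcz := conjugate_pos alpha z Ha (Rlt_le_trans _ _ _ Hx (proj1 Hz))).
    assert (Hd : Rabs (D (conjugate alpha z) alpha) <= Rabs (D z alpha))
      by (apply (adm_decr D HD); lra).
    assert (Hd0 : 0 < Rabs (D (conjugate alpha z) alpha)).
    { apply Rabs_pos_lt, Rgt_not_eq, (adm_pos D HD); assumption. }
    assert (Hi : / Rabs (D z alpha) <= / Rabs (D (conjugate alpha z) alpha))
      by (apply Rinv_le_contravar; assumption).
    assert (Hn : c ^ 2 - alpha ^ 2 / z ^ 2 <= 0).
    { destruct (Rle_lt_or_eq_dec z (alpha / c)) as [L | L]; [lra | |].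
      left; apply sonic_super; lra.
      rewrite L; right; field; lra. }
    assert (E2 : dK z = (alpha ^ 2 / z ^ 2 - c ^ 2) *
      (/ Rabs (D z alpha) - / Rabs (D (conjugate alpha z) alpha))).
    { assert (0 < Rabs (D z alpha)) by lra.
      unfold dK, integrand. set (d1 := Rabs (D (conjugate alpha z) alpha)) in *.
      unfold conjugate. field. repeat split; lra. }
    rewrite E2. nra.
Qed.

Section Gap.
Variables (l m : R -> R).
Hypothesis l_pos : forall alpha, 0 < l alpha.
Hypothesis m_pos : forall alpha, 0 < m alpha.
Hypothesis l_cont : forall alpha, continuity_pt l alpha.
Hypothesis m_cont : forall alpha, continuity_pt m alpha.

(** The loss needed to pass from the density [l alpha] to the density [m alpha] in a
    subsonic flow; a connection requires it to be 1. *)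
Definition gap (alpha : R) : R := F c D alpha (l alpha) - F c D alpha (m alpha).

Lemma segment_pos x y t : 0 < x -> 0 < y -> 0 <= t <= 1 -> 0 < (y - x) * t + x.
Proof. intros; nra. Qed.

(** Mapping the interval of densities onto the unit interval moves the dependence on
    [alpha] of its ends into the integrand. *)
Lemma gap_unit_interval alpha : 0 < alpha ->
  gap alpha = RInt (fun t => (l alpha - m alpha) *
    integrand alpha ((l alpha - m alpha) * t + m alpha)) 0 1.
Proof.
  intros Ha. unfold gap. rewrite F_diff by auto.
  assert (K := RInt_comp_lin (V := R_CompleteNormedModule) (integrand alpha)
    (l alpha - m alpha) (m alpha) 0 1).
  replace ((l alpha - m alpha) * 0 + m alpha) with (m alpha) in K by ring.
  replace ((l alpha - m alpha) * 1 + m alpha) with (l alpha) in K by ring.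
  rewrite <- K; [reflexivity | apply integrand_ex_RInt; auto].
Qed.

(** The integrand on the unit interval is continuous in both variables, hence uniformly
    close to its value at [alpha]. *)
Lemma gap_continuous alpha : 0 < alpha -> continuity_pt gap alpha.
Proof.
  intros Ha.
  set (f := fun a t => (l a - m a) * integrand a ((l a - m a) * t + m a)).
  assert (Cl : forall a t, continuity_2d_pt (fun a _ => l a - m a) a t).
  { intros a t. apply (continuity_1d_2d_pt_comp (fun a => l a - m a) (fun a _ => a)).
    apply continuity_pt_minus; auto. apply continuity_2d_pt_id1. }
  assert (Cf : forall a t, 0 < a -> 0 <= t <= 1 -> continuity_2d_pt f a t).
  { intros a t Ha' Ht. apply continuity_2d_pt_mult; [apply Cl |].
    apply continuity_2d_pt_filterlim.
    apply (filterlim_comp _ _ _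
      (fun z : R * R => (fst z, (l (fst z) - m (fst z)) * snd z + m (fst z)))
      (fun z => integrand (fst z) (snd z)) _ (locally (a, (l a - m a) * t + m a))).
    2: { apply continuity_2d_pt_filterlim, integrand_continuous_2d; [exact Ha' |].
         apply segment_pos; auto. }
    apply (continuous_comp_2 (U := prod_UniformSpace R_UniformSpace R_UniformSpace)
      (V := R_UniformSpace) (W := R_UniformSpace)
      (X := prod_UniformSpace R_UniformSpace R_UniformSpace)
      (fun z => fst z) (fun z => (l (fst z) - m (fst z)) * snd z + m (fst z))
      (fun x y => (x, y)) (a, t)).
    - apply continuous_fst.
    - apply (proj1 (continuity_2d_pt_filterlim
        (fun a t => (l a - m a) * t + m a) a t)).
      apply continuity_2d_pt_plus.
      apply continuity_2d_pt_mult; [apply Cl | apply continuity_2d_pt_id2].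
      apply (continuity_1d_2d_pt_comp m (fun a _ => a)); auto.
      apply continuity_2d_pt_id1.
    - apply continuous_ext with (fun p => p).
      intros []; reflexivity. apply continuous_id. }
  assert (If : forall a, 0 < a -> ex_RInt (f a) 0 1).
  { intros a Ha'. apply (ex_RInt_continuous (f a)).
    rewrite Rmin_left, Rmax_right by lra.
    intros t Ht. apply continuity_2d_slice, Cf; assumption. }
  apply continuity_pt_filterlim, filterlim_locally. intros eps.
  destruct (uniform_continuity_2d_1d' f 0 1 alpha (fun t Ht => Cf alpha t Ha Ht)
    (pos_div_2 eps)) as [d Hd].
  assert (L1 : locally alpha (fun a => 0 < a)) by (apply open_gt; exact Ha).
  assert (L2 : locally alpha (fun a => Rabs (a - alpha) < d)) by (exists d; intros; assumption).
  generalize (filter_and _ _ L1 L2). apply filter_imp. intros a [Ha' Had].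
  change (Rabs (gap a - gap alpha) < eps).
  rewrite !gap_unit_interval by assumption.
  change (Rabs (RInt (f a) 0 1 - RInt (f alpha) 0 1) < eps).
  assert (E := RInt_minus (V := R_CompleteNormedModule) (f a) (f alpha) 0 1
    (If a Ha') (If alpha Ha)).
  unfold minus, plus, opp in E; simpl in E.
  unfold Rminus; rewrite <- E.
  apply Rle_lt_trans with ((1 - 0) * (eps / 2)).
  2: generalize (cond_pos eps); lra.
  apply (norm_RInt_le_const (V := R_CompleteNormedModule) (fun t => f a t + - f alpha t) 0 1).
  - lra.
  - intros t Ht. left. apply (Hd t alpha t a); try assumption.
    + generalize (cond_pos d); lra.
    + apply Rabs_def2 in Had; lra.
    + rewrite Rminus_eq_0, Rabs_R0; apply cond_pos.
  - apply (RInt_correct (V := R_CompleteNormedModule)).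
    apply (ex_RInt_minus (V := R_NormedModule) (f a) (f alpha)); auto.
Qed.

(** A larger flux means a shorter density interval and a stronger drag, hence a smaller
    gap. *)
Lemma gap_decr alpha beta : 0 < alpha -> alpha < beta ->
  alpha / c <= m alpha -> beta / c <= m beta -> m beta <= l beta ->
  m alpha <= m beta -> l beta < l alpha -> gap beta < gap alpha.
Proof.
  intros Ha Hab M1 M2 ML M3 L1. unfold gap.
  assert (Hc : alpha / c < beta / c).
  { apply Rmult_lt_compat_r; [apply Rinv_0_lt_compat |]; assumption. }
  assert (0 < alpha / c) by (apply Rdiv_lt_0_compat; assumption).
  assert (K1 : F c D beta (l beta) - F c D beta (m beta) <=
    F c D alpha (l beta) - F c D alpha (m beta)).
  { rewrite !F_diff by (auto; lra).
    apply RInt_le; [exact ML | apply integrand_ex_RInt; auto; lra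
      | apply integrand_ex_RInt; auto; lra |].
    intros r Hr. unfold integrand.
    assert (0 < D r alpha) by (apply (adm_pos D HD); lra).
    assert (D r alpha <= D r beta) by (apply (adm_incr D HD); lra).
    rewrite !Rabs_right by lra.
    assert (0 < c ^ 2 - beta ^ 2 / r ^ 2) by (apply sonic_sub; lra).
    apply Rmult_le_compat.
    - left; apply Rinv_0_lt_compat; lra.
    - lra.
    - apply Rinv_le_contravar; assumption.
    - assert (alpha ^ 2 / r ^ 2 <= beta ^ 2 / r ^ 2); [| lra].
      apply Rmult_le_compat_r; [| nra].
      left; apply Rinv_0_lt_compat, pow_lt; lra. }
  assert (F c D alpha (l beta) < F c D alpha (l alpha)) by (apply F_incr; lra).
  assert (F c D alpha (m alpha) <= F c D alpha (m beta)) by (apply F_incr_le; lra).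
  lra.
Qed.
End Gap.

(** The drag vanishes with the flux, whereas [c^2 - alpha^2 / r^2] tends to [c^2]. *)
Lemma F_gap_small_flux p q : 0 < p -> p < q -> exists delta, 0 < delta /\
  forall alpha, 0 < alpha < delta -> 1 < F c D alpha q - F c D alpha p.
Proof.
  intros Hp Hpq.
  (* below this bound on the drag, and with [c^2 / 2] as lower bound of the other factor,
     the loss is at least 2 *)
  assert (Heps : 0 < (q - p) * c ^ 2 / 4).
  { apply Rdiv_lt_0_compat; [apply Rmult_lt_0_compat; [| apply pow_lt] |]; lra. }
  destruct (adm_cont D HD p 0 Hp (mkposreal _ Heps)) as [d Hd]. simpl in Hd.
  exists (Rmin d (c * p / 2)). split.
  { apply Rmin_pos; [apply cond_pos | nra]. }
  intros alpha [Ha Hal].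
  assert (alpha < d) by (generalize (Rmin_l d (c * p / 2)); lra).
  assert (Hcp : alpha < c * p / 2) by (generalize (Rmin_r d (c * p / 2)); lra).
  destruct (MVT_gen (F c D alpha) p q (integrand alpha)) as (z & Hz & E).
  - rewrite Rmin_left, Rmax_right by lra. intros z Hz; apply F_derive; lra.
  - rewrite Rmin_left, Rmax_right by lra. intros z Hz; apply F_continuous; lra.
  - rewrite Rmin_left, Rmax_right in Hz by lra. rewrite E. unfold integrand.
    assert (Dz : 0 < D z alpha) by (apply (adm_pos D HD); lra).
    assert (Dle : Rabs (D z alpha) <= Rabs (D p alpha)) by (apply (adm_decr D HD); lra).
    assert (Deps : Rabs (D p alpha) < (q - p) * c ^ 2 / 4).
    { generalize (Hd p alpha). rewrite (adm_0 D HD p Hp), !Rminus_0_r, Rminus_eq_0, Rabs_R0.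
      rewrite (Rabs_right alpha) by lra. intros G; apply G; [apply cond_pos | lra]. }
    assert (Hin : / ((q - p) * c ^ 2 / 4) < / Rabs (D z alpha)).
    { apply Rinv_lt_contravar; [| lra]. apply Rmult_lt_0_compat; [| lra].
      apply Rabs_pos_lt; lra. }
    assert (Hq : c ^ 2 / 2 < c ^ 2 - alpha ^ 2 / z ^ 2).
    { apply Rmult_lt_reg_r with (z ^ 2); [nra |].
      replace ((c ^ 2 - alpha ^ 2 / z ^ 2) * z ^ 2) with ((c * z) * (c * z) - alpha * alpha)
        by (field; lra).
      assert (alpha < c * z / 2) by nra. nra. }
    assert (0 < c ^ 2 / 2) by nra.
    assert (0 < / ((q - p) * c ^ 2 / 4)) by (apply Rinv_0_lt_compat; exact Heps).
    apply Rlt_trans with (/ ((q - p) * c ^ 2 / 4) * (c ^ 2 / 2) * (q - p)).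
    + replace (/ ((q - p) * c ^ 2 / 4) * (c ^ 2 / 2) * (q - p)) with 2 by (field; lra).
      lra.
    + apply Rmult_lt_compat_r; [lra |]. apply Rmult_gt_0_lt_compat; lra.
Qed.

End Drag.

(** * Connecting the two traces *)

Section Connection.
Variable c : R.
Hypothesis c_pos : 0 < c.

(** The pairs of traces of self-similar solutions for a particle at rest. *)
Definition connects (D : R -> R -> R) (UL UR Um Up : state) : Prop :=
  physical Um /\ physical Up /\ trace c UL Um /\ trace c (mirror UR) (mirror Up) /\
  germ c D 0 Um Up.

Lemma connects_mirror D UL UR Um Up : connects D UL UR Um Up ->
  connects (mirror_drag D) (mirror UR) (mirror UL) (mirror Up) (mirror Um).
Proof.
  intros (H1 & H2 & H3 & H4 & H5). unfold connects; rewrite !mirrorK.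
  apply mirror_germ in H5; [| exact c_pos]. rewrite Ropp_0 in H5. tauto.
Qed.

Section Flux.
Variable D : R -> R -> R.
Hypothesis HD : admissible D.
Variables UL UR : state.
Hypothesis PL : physical UL.
Hypothesis PR : physical UR.
Notation l := (ell c UL).
Definition right_threshold (alpha : R) : R := threshold c (mirror UR) (- alpha).
Notation m := right_threshold.
Notation q0 := (crit_mom c UL).
Notation F := (F c D).
Notation total_loss := (gap c D l m).

Let PR' : physical (mirror UR) := mirror_physical UR PR.

Lemma right_threshold_pos alpha : 0 < m alpha.
Proof. apply threshold_pos; assumption. Qed.

Lemma right_threshold_sonic alpha : 0 < alpha -> alpha / c <= m alpha.
Proof.
  intros Ha; unfold right_threshold, threshold. rewrite Rabs_Ropp, Rabs_right by lra. apply Rmax_r.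
Qed.

Lemma right_threshold_ell alpha : ell c (mirror UR) (- alpha) <= m alpha.
Proof. apply Rmax_l. Qed.

Lemma right_threshold_incr alpha beta : 0 < alpha -> alpha <= beta -> m alpha <= m beta.
Proof.
  intros Ha Hab. unfold right_threshold, threshold. rewrite !Rabs_Ropp, !Rabs_right by lra.
  apply Rmax_lub.
  - apply Rle_trans with (ell c (mirror UR) (- beta)); [| apply Rmax_l].
    apply ell_decr; [assumption | assumption | lra].
  - apply Rle_trans with (beta / c); [| apply Rmax_r].
    apply Rmult_le_compat_r; [left; apply Rinv_0_lt_compat |]; lra.
Qed.

Lemma right_threshold_continuous alpha : continuity_pt m alpha.
Proof.
  apply continuity_pt_ext with (fun a =>
    let x := ell c (mirror UR) (- a) in let y := Rabs (- a) / c in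
    (x + y + Rabs (x - y)) / 2).
  { intros a; unfold right_threshold, threshold; simpl.
    unfold Rmax, Rabs at 2.
    destruct (Rle_dec _ _), (Rcase_abs _); lra. }
  assert (C1 : continuity_pt (fun a => ell c (mirror UR) (- a)) alpha).
  { apply (continuity_pt_comp Ropp (ell c (mirror UR))).
    apply continuity_pt_derivable; auto_derive; easy.
    apply ell_continuous; assumption. }
  assert (C2 : continuity_pt (fun a => Rabs (- a) / c) alpha).
  { apply (continuity_pt_comp Ropp (fun a => Rabs a / c)).
    apply continuity_pt_derivable; auto_derive; easy.
    apply (continuity_pt_mult Rabs (fun _ => / c)). apply Rcontinuity_abs.
    apply continuity_pt_const; now intros ? ?. }
  simpl.
  apply (continuity_pt_mult _ (fun _ => / 2)).
  2: apply continuity_pt_const; now intros ? ?.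
  apply continuity_pt_plus. apply continuity_pt_plus; assumption.
  apply (continuity_pt_comp
    (fun a => ell c (mirror UR) (- a) - Rabs (- a) / c) Rabs).
  apply continuity_pt_minus; assumption. apply Rcontinuity_abs.
Qed.

Lemma right_threshold_0 : m 0 = ell c (mirror UR) 0.
Proof.
  unfold right_threshold, threshold. rewrite Ropp_0, Rabs_R0. apply Rmax_left.
  generalize (ell_pos c c_pos (mirror UR) PR' 0). unfold Rdiv; lra.
Qed.

Lemma right_trace_inv Up : physical Up -> trace c (mirror UR) (mirror Up) ->
  0 < snd Up ->
  fst Up = m (snd Up) \/ m (snd Up) < conjugate c (snd Up) (fst Up).
Proof.
  intros P T H.
  destruct (trace_neg_inv c c_pos (mirror UR) (mirror Up)) as [E | E];
    try assumption; simpl in *; [lra | left; exact E | right].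
  fold (m (snd Up)) in E.
  assert (K := conjugate_eq c c_pos (snd Up) (fst Up) P). unfold physical in P.
  apply Rmult_lt_reg_l with (c * (c * 1) * fst Up).
  apply Rmult_lt_0_compat; [nra | exact P].
  simpl in K; lra.
Qed.

Lemma right_trace_intro alpha rho : 0 < alpha -> 0 < rho ->
  rho = m alpha \/ m alpha < conjugate c alpha rho ->
  trace c (mirror UR) (mirror (rho, alpha)).
Proof.
  intros Ha Hr H. apply trace_neg_intro; try assumption; simpl; [lra |].
  destruct H as [H | H]; [left; exact H | right].
  fold (m alpha).
  assert (K := conjugate_eq c c_pos alpha rho Hr).
  replace (- alpha * (- alpha * 1)) with (alpha ^ 2) by ring. rewrite <- K.
  simpl. apply Rmult_lt_compat_l; [| exact H].
  apply Rmult_lt_0_compat; [nra | exact Hr].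
Qed.

(** The other three cases of the germ require [alpha <= 0]. *)
Lemma germ_pos_inv Um Up : germ c D 0 Um Up -> 0 < snd Um ->
  snd Up = snd Um /\
  ((0 <= (snd Um / c - fst Up) * (snd Um / c - fst Um) /\
    F (snd Um) (fst Um) - F (snd Um) (fst Up) = 1) \/
   (fst Um < snd Um / c <= fst Up /\ exists rho,
     fst Um <= rho < snd Um / c /\
     F (snd Um) (fst Um) - F (snd Um) rho <= 1 /\
     F (snd Um) (conjugate c (snd Um) rho) - F (snd Um) (fst Up) =
       1 - (F (snd Um) (fst Um) - F (snd Um) rho))).
Proof.
  intros (Pm & Pp & E & H) Ha. unfold physical in *.
  rewrite !Rmult_0_l, !Rminus_0_r in *. split; [lra |].
  destruct H as [H | [H | [H | [(H1 & H2 & rho & theta & H3) | H]]]].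
  - lra.
  - left; tauto.
  - lra.
  - right. split.
    { split; [| exact H2]. apply Rmult_lt_reg_l with c; [lra |].
      replace (c * (snd Um / c)) with (snd Um) by (field; lra). exact H1. }
    exists rho. unfold conjugate. intuition lra.
  - exfalso. destruct H as [H _]. nra.
Qed.

Lemma germ_regular alpha rm rp : 0 < alpha -> 0 < rm -> 0 < rp ->
  0 <= (alpha / c - rp) * (alpha / c - rm) -> F alpha rm - F alpha rp = 1 ->
  germ c D 0 (rm, alpha) (rp, alpha).
Proof.
  intros Ha Hm Hp H1 H2. split; [exact Hm | split; [exact Hp |]].
  simpl. rewrite !Rmult_0_l, !Rminus_0_r. split; [reflexivity |].
  right; left; tauto.
Qed.

Lemma germ_shock alpha rm rp rho : 0 < alpha -> 0 < rm ->
  alpha / c <= rp -> rm <= rho < alpha / c ->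
  F alpha rm - F alpha rho <= 1 ->
  F alpha (conjugate c alpha rho) - F alpha rp = 1 - (F alpha rm - F alpha rho) ->
  germ c D 0 (rm, alpha) (rp, alpha).
Proof.
  intros Ha Hm Hp Hr H1 H2.
  assert (0 < alpha / c) by (apply Rdiv_lt_0_compat; assumption).
  split; [exact Hm | split; [unfold physical; simpl; lra |]].
  unfold fst, snd. rewrite !Rmult_0_l, !Rminus_0_r. split; [reflexivity |].
  do 3 right; left. split.
  { replace alpha with (c * (alpha / c)) by (field; lra).
    apply Rmult_lt_compat_l; lra. }
  split; [exact Hp |].
  exists rho, (F alpha rm - F alpha rho).
  assert (F alpha rho <= F alpha rm) by (apply F_decr_le; try assumption; lra).
  unfold conjugate in H2. repeat split; try lra.
Qed.

(** A supersonic [UL] has the flux at which the curve of left traces ends, and that end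
    is its conjugate. *)
Lemma super_data : c < vel UL ->
  0 < snd UL /\ fst UL < snd UL / c /\ q0 = snd UL /\ l (snd UL) = conjugate c (snd UL) (fst UL).
Proof.
  intros H. assert (P := PL). unfold physical in P.
  assert (E := snd_vel UL PL).
  destruct (crit_super c c_pos UL PL H) as (K1 & K2 & K3).
  split; [rewrite E; nra |]. split.
  { rewrite E. apply Rmult_lt_reg_l with c; [lra |].
    replace (c * (fst UL * vel UL / c)) with (fst UL * vel UL) by (field; lra). nra. }
  split; [exact K3 |].
  rewrite <- K3. fold q0. rewrite ell_crit_mom by assumption.
  unfold crit_mom; rewrite K3. unfold crit, conjugate.
  destruct (Rle_dec (vel UL) c); [lra |].
  rewrite E at 1. field; lra.
Qed.

(** In the regular regime the left trace is on the curve.  The strict bound on the flux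
    leaves out the flux at which a supersonic [UL] is itself the trace. *)
Definition regular (Um Up : state) : Prop :=
  fst Um = l (snd Um) /\ fst Up = m (snd Um) /\ snd Um <= q0 /\
  (c < vel UL -> snd Um < q0) /\ total_loss (snd Um) = 1.

(** The choked regime, where the supersonic state [UL] reaches the particle unchanged.  The
    bound on [gap] belongs to it because it excludes a regular connection of smaller flux. *)
Definition choked (Um Up : state) : Prop :=
  Um = UL /\ c < vel UL /\ 1 <= total_loss (snd UL) /\
  ((fst Up <= snd UL / c /\ F (snd UL) (fst UL) - F (snd UL) (fst Up) = 1 /\
    (fst Up = m (snd UL) \/ m (snd UL) < conjugate c (snd UL) (fst Up))) \/
   (fst Up = m (snd UL) /\ exists rho, fst UL <= rho < snd UL / c /\
     F (snd UL) (fst UL) - F (snd UL) rho <= 1 /\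
     F (snd UL) (conjugate c (snd UL) rho) - F (snd UL) (fst Up) =
       1 - (F (snd UL) (fst UL) - F (snd UL) rho))).

(** In the regular regime a supersonic exit would require a sonic entrance, where [F]
    vanishes and nothing is left to lose.  In the choked regime the bound on [gap] comes from
    [shock_gain_decr]: placing the shock at the entrance loses at least as much as placing
    it at [rho], or at the exit of a supersonic flow. *)
Lemma connects_pos_inv Um Up : connects D UL UR Um Up -> 0 < snd Um ->
  snd Up = snd Um /\ (regular Um Up \/ choked Um Up).
Proof.
  intros (Pm & Pp & Tl & Tr & G) Ha.
  destruct (germ_pos_inv Um Up G Ha) as [E G'].
  split; [exact E |].
  assert (Tr' := right_trace_inv Up Pp Tr). rewrite E in Tr'. specialize (Tr' Ha).
  destruct (trace_nonneg_inv c c_pos UL Um PL Pm Tl) as [Hq Tl']; [lra |].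
  assert (Hs := right_threshold_sonic (snd Um) Ha).
  assert (Hsp : 0 < snd Um / c) by (apply Rdiv_lt_0_compat; assumption).
  unfold physical in Pm, Pp.
  assert (Hconj : snd Um / c <= fst Up -> fst Up = m (snd Um)).
  { intros H. destruct Tr' as [K | K]; [exact K |]. exfalso.
    assert (c ^ 2 * fst Up * conjugate c (snd Um) (fst Up) = snd Um ^ 2)
      by (apply conjugate_eq; assumption).
    set (s := snd Um / c) in *.
    assert (snd Um = c * s) by (unfold s; field; lra).
    rewrite H1 in H0 at 2.
    assert (s * s < fst Up * conjugate c (snd Um) (fst Up)) by nra.
    assert (c ^ 2 * (s * s) < c ^ 2 * (fst Up * conjugate c (snd Um) (fst Up))).
    { apply Rmult_lt_compat_l; [apply pow_lt; exact c_pos | assumption]. }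
    lra. }
  destruct Tl' as [[El Hsup] | [-> Hsup]].
  - left. assert (Hsub := ell_subsonic c c_pos UL PL (snd Um) Hq).
    rewrite <- El in Hsub.
    destruct G' as [[G1 G2] | [[G1 _] _]]; [| lra].
    assert (Ep : snd Um / c <= fst Up).
    { apply Rnot_lt_le; intros K.
      assert (fst Um = snd Um / c) by nra.
      rewrite H, F_sonic in G2 by assumption.
      assert (0 <= F (snd Um) (fst Up)) by (apply F_sup_nonneg; lra || assumption).
      lra. }
    specialize (Hconj Ep).
    repeat split; try assumption. unfold gap. rewrite <- El, <- Hconj; exact G2.
  - right. destruct (super_data Hsup) as (_ & S1 & S2 & S3).
    split; [reflexivity |]. split; [exact Hsup |].
    assert (Hgap : forall rho, fst UL <= rho <= snd UL / c ->
      F (snd UL) (m (snd UL)) <=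
        F (snd UL) (conjugate c (snd UL) rho) - F (snd UL) rho + F (snd UL) (fst UL) - 1 ->
      1 <= total_loss (snd UL)).
    { intros rho Hr H. unfold gap. rewrite S3.
      generalize (shock_gain_decr c c_pos D HD (snd UL) (fst UL) rho Ha Pm
        (proj1 Hr) (proj2 Hr)). lra. }
    destruct G' as [[G1 G2] | [[_ G1] (rho & G2 & G3 & G4)]].
    + assert (Ep : fst Up <= snd UL / c) by nra.
      assert (fst UL <= fst Up).
      { apply (F_sup_reflect c c_pos D HD (snd UL)); lra. }
      split.
      { apply (Hgap (fst Up)); [lra |].
        assert (F (snd UL) (m (snd UL)) <= F (snd UL) (conjugate c (snd UL) (fst Up)));
          [| lra].
        apply F_incr_le; try assumption.
        destruct Tr' as [K | K]; [| lra].
        assert (K' : fst Up = snd UL / c) by lra.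
        rewrite <- K, K', conjugate_at_sonic by assumption. lra. }
      left. repeat split; assumption.
    + assert (Em := Hconj G1). split.
      { apply (Hgap rho); [lra |]. rewrite <- Em; lra. }
      right. split; [exact Em |]. exists rho. tauto.
Qed.

(** A positive gap forces [right_threshold beta < ell UL beta], which is where [gap_decr]
    applies. *)
Lemma gap_lt alpha beta : 0 < alpha -> alpha < beta -> beta <= q0 -> 0 < total_loss beta ->
  m beta < l beta /\ total_loss beta < total_loss alpha.
Proof.
  intros Ha Hab Hq Hg.
  assert (M := right_threshold_sonic beta). assert (M' := right_threshold_sonic alpha).
  assert (L := ell_subsonic c c_pos UL PL beta Hq).
  assert (Hml : m beta < l beta).
  { apply Rnot_le_lt; intros K. unfold gap in Hg.
    assert (F beta (l beta) <= F beta (m beta)) by (apply F_incr_le; lra || assumption).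
    lra. }
  split; [exact Hml |].
  apply gap_decr; try assumption.
  - intros; apply ell_pos; assumption.
  - apply right_threshold_pos.
  - lra.
  - lra.
  - lra.
  - apply right_threshold_incr; lra.
  - apply ell_decr_strict; lra || assumption.
Qed.

(** Two supersonic exits have the same loss, and two subsonic ones are the only subsonic
    right trace.  In the mixed case the inner shock comes before the supersonic exit is
    reached, so by [shock_gain_decr] the subsonic exit is beyond the conjugate of the
    supersonic one; the right traces leave no room for this unless both are sonic. *)
Lemma choked_unique Um Up Um' Up' : 0 < fst Up -> 0 < fst Up' ->
  choked Um Up -> choked Um' Up' -> fst Up = fst Up'.
Proof.
  intros Pp Pp' (_ & Hc & _ & H) (_ & _ & _ & H').
  destruct (super_data Hc) as (Ha & S1 & S2 & S3).
  assert (Hmix : forall x y rho, 0 < x <= snd UL / c ->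
    F (snd UL) (fst UL) - F (snd UL) x = 1 ->
    (x = m (snd UL) \/ m (snd UL) < conjugate c (snd UL) x) ->
    y = m (snd UL) -> fst UL <= rho < snd UL / c ->
    F (snd UL) (fst UL) - F (snd UL) rho <= 1 ->
    F (snd UL) (conjugate c (snd UL) rho) - F (snd UL) y =
      1 - (F (snd UL) (fst UL) - F (snd UL) rho) -> x = y).
  { intros x y rho Hx K1 K2 -> Hr K3 K4.
    destruct K2 as [K2 | K2]; [exact K2 | exfalso].
    assert (P := PL); unfold physical in P.
    assert (rho <= x) by (apply (F_sup_reflect c c_pos D HD (snd UL)); lra).
    assert (G := shock_gain_decr c c_pos D HD (snd UL) rho x Ha
      (Rlt_le_trans _ _ _ P (proj1 Hr)) H0 (proj2 Hx)).
    assert (conjugate c (snd UL) x <= m (snd UL)); [| lra].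
    apply (F_sub_reflect c c_pos D HD (snd UL)); try assumption.
    - apply conjugate_sonic; lra.
    - apply right_threshold_sonic, Ha.
    - lra. }
  destruct H as [(A1 & A2 & A3) | (B1 & rho & B2 & B3 & B4)],
    H' as [(A1' & A2' & A3') | (B1' & rho' & B2' & B3' & B4')].
  - apply Rle_antisym; apply (F_sup_reflect c c_pos D HD (snd UL)); lra.
  - apply (Hmix _ _ rho'); tauto || lra.
  - symmetry; apply (Hmix _ _ rho); tauto || lra.
  - congruence.
Qed.

(** Regular and choked connections exclude each other: the former has [gap = 1] at a flux
    smaller than that of [UL], where the latter still has [gap >= 1]. *)
Lemma connects_pos_unique Um Up Um' Up' :
  connects D UL UR Um Up -> 0 < snd Um ->
  connects D UL UR Um' Up' -> 0 < snd Um' -> Um = Um' /\ Up = Up'.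
Proof.
  intros C Ha C' Ha'.
  destruct (connects_pos_inv Um Up C Ha) as [E H].
  destruct (connects_pos_inv Um' Up' C' Ha') as [E' H'].
  assert (Hex : forall V V', regular V V' -> 0 < snd V -> c < vel UL ->
    1 <= total_loss (snd UL) -> False).
  { intros V V' (_ & _ & _ & R4 & R5) Hv Hc Hg. specialize (R4 Hc).
    destruct (super_data Hc) as (_ & _ & S2 & _). rewrite S2 in R4.
    destruct (gap_lt (snd V) (snd UL)); lra. }
  destruct H as [H | H], H' as [H' | H'].
  - destruct H as (R1 & R2 & R3 & R4 & R5), H' as (R1' & R2' & R3' & R4' & R5').
    assert (Es : snd Um = snd Um').
    { destruct (Rtotal_order (snd Um) (snd Um')) as [K | [K | K]]; [| exact K |].
      destruct (gap_lt _ _ Ha K R3'); lra.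
      destruct (gap_lt _ _ Ha' K R3); lra. }
    rewrite Es in R1, R2.
    split; apply state_eq; congruence.
  - exfalso. destruct H' as (_ & H1 & H2 & _). apply (Hex Um Up); assumption.
  - exfalso. destruct H as (_ & H1 & H2 & _). apply (Hex Um' Up'); assumption.
  - assert (Ef := choked_unique _ _ _ _ (proj1 (proj2 C)) (proj1 (proj2 C')) H H').
    destruct H as (-> & _), H' as (-> & _).
    split; [reflexivity | apply state_eq; congruence].
Qed.

(** A positive gap means that the density on the left curve exceeds the one on the right
    curve, and lowering the flux to 0 separates them further. *)
Lemma connects_pos_order Um Up : connects D UL UR Um Up -> 0 < snd Um ->
  ell c (mirror UR) 0 < l 0.
Proof.
  intros C Ha. destruct (connects_pos_inv Um Up C Ha) as [_ H].
  assert (G : snd Um <= q0 /\ 0 < total_loss (snd Um)).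
  { destruct H as [(_ & _ & H1 & _ & H2) | (E & H1 & H2 & _)].
    - split; lra.
    - destruct (super_data H1) as (_ & _ & S & _). rewrite E, S; lra. }
  destruct G as [G1 G2].
  destruct (gap_lt (snd Um / 2) (snd Um)) as [G3 _]; try lra.
  assert (l (snd Um) <= l 0) by (apply ell_decr; lra || assumption).
  assert (ell c (mirror UR) 0 <= ell c (mirror UR) (- snd Um))
    by (apply ell_decr; lra || assumption).
  generalize (right_threshold_ell (snd Um)); lra.
Qed.

(** Let [sigma] be the density reached at the exit without a shock, or the sonic one if the
    flow cannot stay supersonic that long.  If the flow can stay supersonic
    and [sigma] is a right trace, it is the exit.
    Otherwise an inner shock at a density between [fst UL] and [sigma] leads to
    [right_threshold]: placed at the entrance it makes the loss at least 1, by [1 <= gap],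
    and placed at [sigma] at most 1. *)
Lemma choked_exists : c < vel UL -> 1 <= total_loss (snd UL) ->
  exists Up, connects D UL UR UL Up.
Proof.
  intros Hc Hg. destruct (super_data Hc) as (Ha & S1 & S2 & S3).
  unfold gap in Hg. rewrite S3 in Hg.
  set (al := snd UL) in *. set (rL := fst UL) in *.
  assert (P : 0 < rL) by exact PL.
  assert (EU : UL = (rL, al)) by (apply state_eq; reflexivity).
  assert (TL : trace c UL UL) by (apply trace_self; lra || assumption).
  assert (Hm := right_threshold_sonic al Ha).
  assert (Fm := F_sub_nonneg c c_pos D HD al (m al) Ha Hm).
  (* the last premise keeps the shock away from the sonic density, where it would be void *)
  assert (Hshock : forall sigma, rL <= sigma <= al / c ->
    F al rL - F al sigma <= 1 ->
    F al (conjugate c al sigma) - F al sigma + F al rL - 1 <= F al (m al) ->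
    (sigma = al / c -> F al rL - 1 < F al (m al)) ->
    exists Up, connects D UL UR UL Up).
  { intros sigma Hs K1 K2 K3.
    destruct (ivt (fun x => F al (conjugate c al x) - F al x) rL sigma
      (F al (m al) - F al rL + 1)) as (rho & Hr & Er).
    - lra.
    - intros x Hx. apply continuity_pt_minus.
      apply (continuity_pt_comp (conjugate c al) (F al)).
      apply conjugate_continuous; lra.
      apply F_continuous; try assumption. apply conjugate_pos; lra.
      apply F_continuous; lra || assumption.
    - right. lra.
    - assert (Hr' : rho < al / c).
      { destruct (Rle_lt_or_eq_dec rho (al / c)) as [L | L]; [lra | exact L |].
        rewrite L, conjugate_at_sonic, F_sonic in Er by assumption.
        assert (sigma = al / c) by lra. specialize (K3 H). lra. }
      exists (m al, al).
      split; [exact PL |]. split; [apply right_threshold_pos |]. split; [exact TL |].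
      split; [apply right_trace_intro; [assumption | apply right_threshold_pos | left; easy] |].
      rewrite EU. apply germ_shock with rho; try assumption; try lra.
      assert (F al sigma <= F al rho) by (apply F_decr_le; lra || assumption). lra. }
  destruct (Rlt_or_le (F al rL) 1) as [H1 | H1].
  { apply (Hshock (al / c)); rewrite ?conjugate_at_sonic, ?F_sonic by assumption; lra. }
  destruct (ivt (F al) rL (al / c) (F al rL - 1)) as (sigma & Hs & Es).
  - lra.
  - intros x Hx; apply F_continuous; lra || assumption.
  - right. rewrite F_sonic by assumption. lra.
  - destruct (Rlt_or_le (m al) (conjugate c al sigma)) as [K | K].
    + exists (sigma, al). 
      split; [exact PL |]. split; [unfold physical; simpl; lra |]. split; [exact TL |].
      split; [apply right_trace_intro; [assumption | lra | right; exact K] |].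
      rewrite EU. apply germ_regular; try lra. nra.
    + assert (Hcs : al / c <= conjugate c al sigma) by (apply conjugate_sonic; lra).
      assert (KF : F al (conjugate c al sigma) <= F al (m al)) by (apply F_incr_le; assumption).
      destruct (Req_dec (m al) (al / c)) as [L | L].
      * (* [sigma] and its conjugate are on both sides of the sonic density, which is
           now an upper bound of the conjugate *)
        assert (E1 : sigma = al / c).
        { assert (conjugate c al sigma = al / c) by lra.
          assert (E1 := conjugate_eq c c_pos al sigma (Rlt_le_trans _ _ _ P (proj1 Hs))).
          rewrite H in E1.
          apply Rmult_eq_reg_l with (c * al). 2: nra.
          transitivity (c ^ 2 * sigma * (al / c)); [field; lra | rewrite E1; field; lra]. }
        exists (sigma, al).
        split; [exact PL |]. split; [unfold physical; simpl; lra |]. split; [exact TL |].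
        split; [apply right_trace_intro; [assumption | lra | left; congruence] |].
        rewrite EU. apply germ_regular; try lra. nra.
      * apply (Hshock sigma); try lra.
        intros ->. rewrite F_sonic in Es by assumption.
        assert (0 < F al (m al)); [| lra].
        rewrite <- (F_sonic c D al Ha). apply F_incr; lra || assumption.
Qed.

(** Unless the flow is choked, [gap] decreases from above 1, at a small flux, to below 1 at
    the largest flux, and the intermediate value theorem applies.  If [UL] is subsonic the
    curve ends at a sonic state, where [gap] is nonpositive. *)
Lemma connects_pos_exists : ell c (mirror UR) 0 < l 0 ->
  exists Um Up, connects D UL UR Um Up.
Proof.
  intros H0. assert (Hq := crit_mom_pos c c_pos UL PL).
  destruct (Rle_or_lt 1 (total_loss q0)) as [Hg | Hg].
  { assert (Hc : c < vel UL).
    { apply Rnot_le_lt; intros K.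
      destruct (crit_sub c c_pos UL PL K) as (K1 & _ & K2).
      unfold gap in Hg. rewrite ell_crit_mom in Hg by assumption.
      replace (crit c UL) with (q0 / c) in Hg
        by (unfold crit_mom; rewrite K2; field; lra).
      rewrite F_sonic in Hg by assumption.
      assert (0 <= F q0 (m q0)).
      { apply F_sub_nonneg; try assumption. apply right_threshold_sonic; assumption. }
      lra. }
    exists UL. apply choked_exists; [exact Hc |].
    destruct (super_data Hc) as (_ & _ & <- & _). exact Hg. }
  set (r0 := ell c (mirror UR) 0) in *.
  assert (Pr0 : 0 < r0) by (apply ell_pos; assumption).
  set (p := (2 * r0 + l 0) / 3). set (q := (r0 + 2 * l 0) / 3).
  destruct (F_gap_small_flux c c_pos D HD p q) as (d & Hd & Hgap);
    [unfold p; lra | unfold p, q; lra |].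
  assert (L1 : locally 0 (fun a => q < l a)).
  { assert (C := ell_continuous c c_pos UL PL 0). apply continuity_pt_filterlim in C.
    apply C, open_gt. unfold q; lra. }
  assert (L2 : locally 0 (fun a => m a < p)).
  { assert (C := right_threshold_continuous 0). apply continuity_pt_filterlim in C.
    apply (C (fun x => x < p)), open_lt. rewrite right_threshold_0. fold r0. unfold p; lra. }
  destruct (filter_and _ _ L1 L2) as [e He].
  set (a1 := Rmin (e / 2) (Rmin (d / 2) (q0 / 2))).
  assert (Ha1 : 0 < a1).
  { repeat apply Rmin_pos; generalize (cond_pos e); lra. }
  assert (a1 <= e / 2 /\ a1 <= d / 2 /\ a1 <= q0 / 2).
  { unfold a1. generalize (Rmin_l (e / 2) (Rmin (d / 2) (q0 / 2)))
    (Rmin_r (e / 2) (Rmin (d / 2) (q0 / 2))) (Rmin_l (d / 2) (q0 / 2))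
    (Rmin_r (d / 2) (q0 / 2)). lra. }
  destruct (He a1) as [Hl Hm].
  { change (Rabs (a1 - 0) < e). rewrite Rminus_0_r, Rabs_right by lra.
    generalize (cond_pos e); lra. }
  assert (Hg1 : 1 < total_loss a1).
  { specialize (Hgap a1). unfold gap.
    assert (Hs := right_threshold_sonic a1 Ha1).
    assert (p < q) by (unfold p, q; lra).
    assert (F a1 q <= F a1 (l a1)) by (apply F_incr_le; lra || assumption).
    assert (F a1 (m a1) <= F a1 p) by (apply F_incr_le; lra || assumption).
    lra. }
  destruct (ivt total_loss a1 q0 1) as (al & Hal & Eal).
  - lra.
  - intros a Ha. apply gap_continuous; try assumption; try lra.
    + intros; apply ell_pos; assumption.
    + apply right_threshold_pos.
    + intros; apply ell_continuous; assumption.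
    + apply right_threshold_continuous.
  - right; lra.
  - assert (Hlt : al < q0).
    { destruct Hal as [_ [L | L]]; [exact L |]. rewrite L in Eal; lra. }
    assert (Hs := right_threshold_sonic al).
    assert (Hs' := ell_subsonic c c_pos UL PL al (Rlt_le _ _ Hlt)).
    exists (l al, al), (m al, al).
    split; [apply ell_pos; assumption |]. split; [apply right_threshold_pos |].
    split; [apply trace_nonneg_intro; lra || assumption |].
    split; [apply right_trace_intro; [lra | apply right_threshold_pos | left; easy] |].
    apply germ_regular; try lra.
    + apply ell_pos; assumption.
    + apply right_threshold_pos.
    + specialize (Hs ltac:(lra)). nra.
    + exact Eal.
Qed.

Lemma connects_zero_inv Um Up : connects D UL UR Um Up -> snd Um = 0 ->
  Um = (l 0, 0) /\ Up = (l 0, 0) /\ l 0 = ell c (mirror UR) 0.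
Proof.
  intros (Pm & Pp & Tl & Tr & (_ & _ & E & G)) H0.
  rewrite !Rmult_0_l, !Rminus_0_r in *. rewrite H0 in *.
  assert (Hzero : forall V U, physical V -> physical U -> trace c V U -> snd U = 0 ->
    fst U = ell c V 0).
  { intros V U PV PU T HU.
    destruct (trace_nonneg_inv c c_pos V U PV PU T) as [_ [[K _] | [-> K]]].
    - lra.
    - rewrite HU in K; exact K.
    - assert (0 < snd V) by (apply vel_pos_snd; lra || assumption). lra. }
  assert (Kl := Hzero UL Um PL Pm Tl H0).
  assert (Kr : fst Up = ell c (mirror UR) 0).
  { apply (Hzero (mirror UR) (mirror Up)); try assumption. simpl; lra. }
  unfold physical in *.
  destruct G as [(_ & G & _) | [G | [G | [G | G]]]]; try (exfalso; nra).
  repeat split; try lra; apply state_eq; simpl; lra.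
Qed.

Lemma connects_zero_exists : l 0 = ell c (mirror UR) 0 ->
  connects D UL UR (l 0, 0) (l 0, 0).
Proof.
  intros E. assert (Hq := crit_mom_pos c c_pos UL PL).
  assert (Hq' := crit_mom_pos c c_pos (mirror UR) PR').
  assert (P := ell_pos c c_pos UL PL 0).
  split; [exact P |]. split; [exact P |].
  split; [apply trace_nonneg_intro; lra || assumption |].
  split.
  { rewrite E. unfold mirror at 2; simpl; rewrite Ropp_0.
    apply trace_nonneg_intro; lra || assumption. }
  split; [exact P |]. split; [exact P |].
  simpl. split; [reflexivity |]. left. repeat split; ring.
Qed.
End Flux.

(** Comparing the densities at rest [ell UL 0] and [ell (mirror UR) 0] decides the sign
    of the flux; negative fluxes are mirror images of positive ones. *)
Lemma connects_exists_unique D UL UR : admissible D -> physical UL -> physical UR ->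
  exists Um Up, connects D UL UR Um Up /\
    forall Um' Up', connects D UL UR Um' Up' -> Um' = Um /\ Up' = Up.
Proof.
  intros HD PL PR.
  assert (HD' := mirror_admissible D HD).
  assert (PL' := mirror_physical UL PL). assert (PR' := mirror_physical UR PR).
  assert (Kpos : forall Um Up, connects D UL UR Um Up -> 0 < snd Um ->
    ell c (mirror UR) 0 < ell c UL 0) by (exact (connects_pos_order D HD UL UR PL PR)).
  assert (Kneg : forall Um Up, connects D UL UR Um Up -> snd Um < 0 ->
    0 < snd (mirror Up) /\ ell c UL 0 < ell c (mirror UR) 0).
  { intros Um Up C Hs. assert (C' := connects_mirror _ _ _ _ _ C).
    assert (0 < snd (mirror Up)).
    { destruct C as (_ & _ & _ & _ & (_ & _ & E & _)). simpl. lra. }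
    split; [assumption |].
    rewrite <- (mirrorK UL). apply (connects_pos_order _ HD' (mirror UR) (mirror UL) PR' PL' _ _ C');
      assumption. }
  assert (Kzero : forall Um Up, connects D UL UR Um Up -> snd Um = 0 ->
    ell c UL 0 = ell c (mirror UR) 0).
  { intros Um Up C Hs. apply (connects_zero_inv D UL UR PL PR Um Up C Hs). }
  destruct (Rtotal_order (ell c UL 0) (ell c (mirror UR) 0)) as [L | [L | L]].
  - destruct (connects_pos_exists (mirror_drag D) HD' (mirror UR) (mirror UL) PR' PL')
      as (Vm & Vp & C). { rewrite mirrorK; exact L. }
    assert (C0 := connects_mirror _ _ _ _ _ C).
    rewrite !mirrorK, mirror_dragK in C0.
    assert (Sgn : forall Wm Wp, connects D UL UR Wm Wp -> 0 < snd (mirror Wp)).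
    { intros Wm Wp CW. destruct (Rtotal_order (snd Wm) 0) as [K | [K | K]].
      - apply (Kneg Wm Wp CW K).
      - generalize (Kzero Wm Wp CW K); lra.
      - generalize (Kpos Wm Wp CW K); lra. }
    exists (mirror Vp), (mirror Vm). split; [exact C0 |].
    intros Um Up C'.
    destruct (connects_pos_unique (mirror_drag D) HD' (mirror UR) (mirror UL) PR' PL'
      (mirror Up) (mirror Um) Vm Vp) as [E1 E2].
    + apply connects_mirror, C'.
    + apply (Sgn Um), C'.
    + apply connects_mirror in C0. rewrite !mirrorK in C0. exact C0.
    + generalize (Sgn _ _ C0). rewrite mirrorK; easy.
    + rewrite <- E1, <- E2, !mirrorK; easy.
  - exists (ell c UL 0, 0), (ell c UL 0, 0).
    split; [apply connects_zero_exists; assumption |].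
    intros Um Up C. destruct (Rtotal_order (snd Um) 0) as [K | [K | K]].
    + destruct (Kneg Um Up C K); lra.
    + destruct (connects_zero_inv D UL UR PL PR Um Up C K) as (E1 & E2 & _); auto.
    + generalize (Kpos Um Up C K); lra.
  - destruct (connects_pos_exists D HD UL UR PL PR L) as (Um & Up & C).
    exists Um, Up; split; [exact C |].
    assert (Sgn : forall Vm Vp, connects D UL UR Vm Vp -> 0 < snd Vm).
    { intros Vm Vp CV. destruct (Rtotal_order (snd Vm) 0) as [K | [K | K]].
      - destruct (Kneg Vm Vp CV K); lra.
      - generalize (Kzero Vm Vp CV K); lra.
      - exact K. }
    intros Um' Up' C'.
    apply (connects_pos_unique D HD UL UR PL PR Um' Up' Um Up); eauto.
Qed.
End Connection.

(** * Arbitrary particle velocity *)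

Section Traces.
Variable c : R.
Hypothesis c_pos : 0 < c.

Lemma filterlim_shift_left a b : filterlim (fun x => x + a) (at_left b) (at_left (b + a)).
Proof.
  intros Q [d Hd]; exists d; intros y Hy Hlt.
  apply Hd; [| lra].
  change (Rabs (y + a - (b + a)) < d). replace (y + a - (b + a)) with (y - b) by ring.
  exact Hy.
Qed.

Lemma filterlim_shift_right a b :
  filterlim (fun x => x + a) (at_right b) (at_right (b + a)).
Proof.
  intros Q [d Hd]; exists d; intros y Hy Hlt.
  apply Hd; [| lra].
  change (Rabs (y + a - (b + a)) < d). replace (y + a - (b + a)) with (y - b) by ring.
  exact Hy.
Qed.

Lemma shift_left_limit a b W U : filterlim W (at_left (b + a)) (locally U) ->
  filterlim (shift_profile a W) (at_left b) (locally (shift a U)).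
Proof.
  intros H. unfold shift_profile.
  apply (filterlim_comp _ _ _ (fun x => W (x + a)) (shift a) _ (locally U)).
  2: apply shift_continuous.
  apply (filterlim_comp _ _ _ (fun x => x + a) W _ (at_left (b + a))).
  apply filterlim_shift_left. exact H.
Qed.

Lemma shift_right_limit a b W U : filterlim W (at_right (b + a)) (locally U) ->
  filterlim (shift_profile a W) (at_right b) (locally (shift a U)).
Proof.
  intros H. unfold shift_profile.
  apply (filterlim_comp _ _ _ (fun x => W (x + a)) (shift a) _ (locally U)).
  2: apply shift_continuous.
  apply (filterlim_comp _ _ _ (fun x => x + a) W _ (at_right (b + a))).
  apply filterlim_shift_right. exact H.
Qed.

Lemma mirror_right_limit W U : filterlim W (at_right 0) (locally U) ->
  filterlim (mirror_profile W) (at_left 0) (locally (mirror U)).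
Proof.
  intros H. unfold mirror_profile.
  apply (filterlim_comp _ _ _ (fun x => W (- x)) mirror _ (locally U)).
  2: apply mirror_continuous.
  apply (filterlim_comp _ _ _ Ropp W _ (at_right 0)); [| exact H].
  rewrite <- Ropp_0 at 2. apply filterlim_Ropp_left.
Qed.

Lemma mirror_left_limit W U : filterlim W (at_left 0) (locally U) ->
  filterlim (mirror_profile W) (at_right 0) (locally (mirror U)).
Proof.
  intros H. unfold mirror_profile.
  apply (filterlim_comp _ _ _ (fun x => W (- x)) mirror _ (locally U)).
  2: apply mirror_continuous.
  apply (filterlim_comp _ _ _ Ropp W _ (at_left 0)); [| exact H].
  rewrite <- Ropp_0 at 2. apply filterlim_Ropp_right.
Qed.

Lemma left_trace_iff v UL U : physical UL -> physical U ->
  trace c (shift v UL) (shift v U) <->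
  exists W, euler_riemann c UL U W /\ filterlim W (at_left v) (locally U).
Proof.
  intros PL P; split.
  - intros (W & HW & HU). exists (shift_profile (- v) W). split.
    + apply (shift_euler c (- v)) in HW; try assumption. rewrite !shiftK in HW; exact HW.
    + rewrite <- (shiftK v U). apply shift_left_limit.
      replace (v + - v) with 0 by ring. exact HU.
  - intros (W & HW & HU). exists (shift_profile v W). split.
    + apply shift_euler; assumption.
    + apply shift_left_limit. rewrite Rplus_0_l. exact HU.
Qed.

Lemma right_trace_iff v UR U : physical UR -> physical U ->
  trace c (mirror (shift v UR)) (mirror (shift v U)) <->
  exists W, euler_riemann c U UR W /\ filterlim W (at_right v) (locally U).
Proof.
  intros PR P; split.
  - intros (W & HW & HU). exists (shift_profile (- v) (mirror_profile W)). split.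
    + apply mirror_euler in HW. rewrite !mirrorK in HW.
      apply (shift_euler c (- v)) in HW; try assumption. rewrite !shiftK in HW; exact HW.
    + rewrite <- (shiftK v U). apply shift_right_limit.
      replace (v + - v) with 0 by ring.
      rewrite <- (mirrorK (shift v U)). apply mirror_left_limit, HU.
  - intros (W & HW & HU). exists (mirror_profile (shift_profile v W)). split.
    + apply mirror_euler, shift_euler; assumption.
    + apply mirror_right_limit, shift_right_limit. rewrite Rplus_0_l. exact HU.
Qed.

Lemma shift_inj v U V : shift v U = shift v V -> U = V.
Proof. intros H; rewrite <- (shiftK v U), H; apply shiftK. Qed.
End Traces.

Theorem theorem3p1 (c : R) (c_pos : 0 < c) (D : R -> R -> R)
    (HD : drag_force D) (rhoL qL rhoR qR v : R)
    (HL : 0 < rhoL) (HR : 0 < rhoR) :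
  exists w : R -> R * R,
    self_similar_solution c D v (rhoL, qL) (rhoR, qR) w /\
    forall w' : R -> R * R,
      self_similar_solution c D v (rhoL, qL) (rhoR, qR) w' ->
      eq_off_finite w w'.
Proof.
  set (UL := (rhoL, qL)). set (UR := (rhoR, qR)).
  assert (PL : physical UL) by exact HL. assert (PR : physical UR) by exact HR.
  destruct (connects_exists_unique c c_pos D (shift v UL) (shift v UR)
    (drag_admissible D HD) PL PR) as (Vm & Vp & (Pm & Pp & Tl & Tr & G) & Huniq).
  set (Um := shift (- v) Vm). set (Up := shift (- v) Vp).
  assert (shift_Um : shift v Um = Vm).
  { unfold Um; rewrite <- (Ropp_involutive v) at 1; apply shiftK. }
  assert (shift_Up : shift v Up = Vp).
  { unfold Up; rewrite <- (Ropp_involutive v) at 1; apply shiftK. }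
  rewrite <- shift_Um in Tl. rewrite <- shift_Up in Tr.
  destruct (proj1 (left_trace_iff c v UL Um PL Pm) Tl) as (Wl & El & Ll).
  destruct (proj1 (right_trace_iff c v UR Up PR Pp) Tr) as (Wr & Er & Lr).
  exists (fun xi => if Rlt_dec xi v then Wl xi else Wr xi). split.
  - exists Um, Up, Wl, Wr.
    repeat (split; [assumption |]).
    split. { intros xi Hxi; destruct (Rlt_dec xi v); [reflexivity | lra]. }
    repeat (split; [assumption |]).
    split. { intros xi Hxi; destruct (Rlt_dec xi v); [lra | reflexivity]. }
    apply unshift_germ, G.
  - intros w' (Um' & Up' & Wl' & Wr' & Pm' & Pp' & El' & Ll' & El2 & Er' & Lr' & Er2 & G').
    destruct (Huniq (shift v Um') (shift v Up')) as [Em Ep].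
    { split; [exact Pm' |]. split; [exact Pp' |].
      split; [apply left_trace_iff; eauto |].
      split; [apply right_trace_iff; eauto |].
      apply shift_germ, G'. }
    rewrite <- shift_Um in Em. rewrite <- shift_Up in Ep.
    apply shift_inj in Em. apply shift_inj in Ep. subst Um' Up'.
    destruct (euler_unique c c_pos UL Um Wl Wl' PL Pm' El El') as [ll Hll].
    destruct (euler_unique c c_pos Up UR Wr Wr' Pp' PR Er Er') as [lr Hlr].
    exists (v :: ll ++ lr). intros xi Hxi. simpl in Hxi. rewrite in_app_iff in Hxi.
    destruct (Rlt_dec xi v).
    + rewrite El2 by assumption. apply Hll; tauto.
    + assert (v < xi).
      { apply Rnot_le_lt; intros K. apply Hxi; left; lra. }
      rewrite Er2 by assumption. apply Hlr; tauto.
Qed.
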